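(* For a positive integer $N$ let $\Psi(N)=N\log N\log\log N\cdots$, where the product is taken over those of the terms $N,\log N,\log\log N,\ldots$ that exceed $1$. (1) Let $T$ be a measure-preserving transformation of a probability space $(X,\mu)$, let $f\in L^1(X,\mu)$ and let $(a_n)_{n\ge1}$ be an arbitrary sequence of integers. Then $$\lim_{N\to\infty}\frac{1}{\Psi(N)}\sum_{n=1}^N f(T^{a_n}x)=0\quad\text{for a.e. }x.$$ (2) Let $T$ be an aperiodic measure-preserving transformation of a probability space $(X,\mu)$ and let the sequence of positive real numbers $(M_N)$ satisfy $M_N/\Psi(N)\to0$ as $N\to\infty$. Then there exist $f\in L^1(X,\mu)$ and a sequence $(a_n)_{n\ge1}$ of integers such that $$\limsup_{N\to\infty}\frac{1}{M_N}\sum_{n=1}^N f(T^{a_n}x)=\infty\quad\text{for a.e. }x.$$ Further, the sequence $(a_n)$ may be taken to be the sequence $a_n=2^n$.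
   Context: $\log$ is the natural logarithm; the product $N\log N\log\log N\cdots$ includes $N$ and the iterated logarithms of $N$ that are defined and exceed $1$ (an empty product is $1$). A measure-preserving transformation $T$ of a probability space $(X,\mu)$ is aperiodic if $\mu\{x: T^nx=x\text{ for some }n\ge1\}=0$. If $T$ is not invertible, sequences of times $(a_n)$ are understood to consist of non-negative integers.
   Formalization: Part (2) assumes that countably many measurable sets separate the points of X off a null set (true for standard and Lebesgue spaces); on an arbitrary probability space it fails, e.g. for x ↦ x+1 on the integers with the trivial sigma-algebra and M_N = N. *)

(* Defs.v *)
From HB Require Import structures.
From mathcomp Require Import all_boot all_order all_algebra.
From mathcomp Require Import all_classical all_reals all_analysis.

Set Implicit Arguments.
Unset Strict Implicit.
Unset Printing Implicit Defensive.

Import Order.TTheory GRing.Theory Num.Theory.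
Import numFieldNormedType.Exports.

Local Open Scope classical_set_scope.
Local Open Scope ring_scope.

(* Since [ln x = 0] for [x <= 0], the iterates beyond the point where the
   iterated logarithm is no longer defined are never greater than [1]. *)
Definition iterlog (R : realType) (k N : nat) : R := iter k (@ln R) N%:R.

Definition Psi (R : realType) (N : nat) : R :=
  \big[*%R/1]_(k \in [set k | 1 < iterlog R k N]) iterlog R k N.

(* The product in [Psi] is a genuine finite product; [\big[_/_]_(_ \in _)] would
   take the default value [1] on an infinite support. *)
Lemma finite_Psi_support (R : realType) (N : nat) :
  finite_set [set k | 1 < iterlog R k N].
Proof.
have bound k : 1 < iterlog R k N -> iterlog R k N <= N%:R - k%:R.
  elim: k => [_|k IH]; first by rewrite /iterlog /= subr0.
  rewrite /iterlog iterS -/(iterlog R k N) => ln_gt1.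
  have gt1 : 1 < iterlog R k N.
    rewrite ltNge; apply/negP => /ln_le0 le0.
    by have := lt_le_trans ln_gt1 le0; rewrite ltr10.
  have := @le_ln1Dx R (iterlog R k N - 1).
  rewrite addrCA subrr addr0 => /(_ _)/le_trans-> //.
    by rewrite ltrBrDr addNr (lt_trans ltr01).
  by rewrite -natr1 opprD addrA lerD2r IH.
apply: (@sub_finite_set _ _ `I_N) (finite_II N) => k /= gt1.
by rewrite -(ltr_nat R) -subr_gt0 (lt_le_trans ltr01) ?(le_trans (ltW gt1)) ?bound.
Qed.

Section Transformations.
Context (d : measure_display) (X : measurableType d) (R : realType).
Variable mu : probability X R.
Implicit Types (T S : X -> X) (a : nat -> int).

Definition measure_preserving T :=
  measurable_fun setT T /\
  forall A, measurable A -> mu (T @^-1` A) = mu A.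

(* Invertibility is understood modulo null sets; such an [S] is unique up to
   almost everywhere equality and is automatically measure preserving. *)
Definition ae_inverse T S :=
  [/\ measurable_fun setT S,
      {ae mu, forall x, S (T x) = x} & {ae mu, forall x, T (S x) = x}].

(* The power [T ^ k], where [S] plays the role of the inverse of [T]; [S] is
   used for negative [k] only ([Negz n] is [- n.+1]). *)
Definition tpow T S (k : int) : X -> X :=
  match k with
  | Posz n => iter n T
  | Negz n => iter n.+1 S
  end.

(* Negative times are allowed only if [T] is invertible with inverse [S];
   otherwise [S] is irrelevant. Sequences are indexed from [1]. *)
Definition admissible_times T S a :=
  ae_inverse T S \/ forall n, (0 < n)%N -> 0 <= a n.

Definition orbit_sum T S (f : X -> R) a (N : nat) (x : X) : R :=
  \sum_(1 <= n < N.+1) f (tpow T S (a n) x).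

Definition aperiodic T :=
  mu.-negligible [set x | exists2 n, (0 < n)%N & iter n T x = x].

(* The regularity of the space that makes pointwise aperiodicity meaningful. It
   holds for standard Borel probability spaces and for Lebesgue-Rokhlin spaces.
   On the trivial sigma-algebra of an infinite set, by contrast, a transformation
   without periodic points acts as the identity on every measurable function. *)
Definition countably_separated :=
  exists A : nat -> set X, (forall i, measurable (A i)) /\
  exists2 Z : set X, mu.-negligible Z &
    forall x y, ~ Z x -> ~ Z y -> (forall i, A i x <-> A i y) -> x = y.

End Transformations.

(* Main.v *)
Require Import Defs.
From HB Require Import structures.
From mathcomp Require Import all_boot all_order all_algebra.
From mathcomp Require Import all_classical all_reals all_analysis.
From mathcomp Require Import measurable_realfun.
From mathcomp Require Import zify ring lra.

Set Implicit Arguments.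
Unset Strict Implicit.
Unset Printing Implicit Defensive.

Import Order.TTheory GRing.Theory Num.Theory.
Import numFieldNormedType.Exports.

Local Open Scope classical_set_scope.
Local Open Scope ring_scope.

(** Write L_k for the k-th iterate of the logarithm and let the towers
    t_0 = 1, t_(k+1) = exp t_k cut the integers into levels t_k < N <= t_(k+1).
    On one level Psi N is the product of N and its first k iterated logarithms,
    that is, the reciprocal of the derivative of L_(k+1), which increases there
    from 0 to 1. So the sum of 1/Psi over each level is of order 1
    ([sum_weight], [level_full_sum]); both halves of the theorem live on this.

    Upper bound. Only the common distribution of the functions f o T^(a_n)
    matters, not their dependence. For N in level k, values of |f| below t_(k-2)
    contribute a negligible multiple of Psi N, since Psi N / N is at least t_(k-1);
    values above t_(k+1) do not occur among the first N terms for large k, the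
    expected number of such occurrences being summable in k. The sum of
    the remaining values, divided by Psi N, is at most the sum of weights of
    order 1/Psi n times the n-th value, uniformly in N, and by [sum_weight] the
    expectation of this majorant is of the order of the integral of |f| over
    values between t_(k-2) and t_(k+1). These ranges of values overlap boundedly,
    so the majorants have a finite total integral and tend to 0 almost
    everywhere ([upper_bound]).

    Lower bound. It suffices to find, for small eps, a multiple lam 1_B of an
    indicator of integral at most eps such that outside a set of measure eps some
    N has a sum of order eps Psi N along the times 2^n ([level_function]); such
    functions are then added up with eps = 2^-s and the Borel-Cantelli lemma
    applies ([lower_bound]). To build B, suppose first that x is described by an
    integer z, that T decreases z by 1, and that the binary digits of z are
    random. A shift by 2^n clears the n-th digit when that digit is 1 and changes
    no other digit. This is the geometry of the Hamming code. Split the times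
    into q consecutive windows, and let the syndrome of z be the sum modulo q of
    g times the number of digits 1 in the g-th window. Let B be given by
    syndrome 0, a set of density 1/q. If the syndrome of z is g, then every shift
    by 2^n at a digit 1 in the g-th window hits B, and about half of the digits
    there are 1. Hence every point of the space is served by exactly one window.
    With lam = q eps / 2, windows of length Psi / (8 q) suffice, and because
    1/Psi has a sum of order 1 over the range available, all q windows fit
    ([good_windows]).

    The integer z comes from a Rokhlin tower: z is the time after which the orbit
    first enters a rare set that almost every orbit visits ([sweep_out]), plus an
    offset. Averaging over the offset and over a translate of the syndrome makes
    the digits and the syndrome exactly uniform, whatever the distribution of the
    entrance time. *)

(** * Iterated logarithms and the function Psi *)

Section IteratedLog.
Variable R : realType.
Implicit Types (x y : R) (j k n N : nat).

Definition tower k : R := iter k expR 1.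

Definition lprod k x : R := \prod_(j < k) iter j (@ln R) x.

Lemma towerS k : tower k.+1 = expR (tower k).
Proof. by []. Qed.

Lemma expR1_ge2 : 2 <= expR (1 : R).
Proof. by have := expR_ge1Dx (1 : R); rewrite -[1 + 1]/(2%:R). Qed.

Lemma expR_ge_double y : 2 * y <= expR y.
Proof.
have := expR_ge1Dx (y - 1); rewrite addrCA subrr addr0 => y_le.
rewrite -[y in expR y](subrK 1) expRD mulrC.
have [y0|y0] := leP 0 y; last first.
  by rewrite (@le_trans _ _ 0) ?mulr_ge0 ?expR_ge0// nmulr_rle0// ltW.
by rewrite ler_pM// expR1_ge2.
Qed.

(** By [expR_ge_double] the exponential at y / 2 is at least y. *)
Lemma sqr_le_expR y : 0 <= y -> y ^+ 2 <= expR y.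
Proof.
move=> y0; have := expR_ge_double (y / 2); rewrite mulrCA divff// mulr1 => h.
have -> : expR y = expR (y / 2) ^+ 2 by rewrite -expRM_natl mulrCA divff ?mulr1.
by rewrite ler_pXn2r// nnegrE expR_ge0.
Qed.

Lemma tower_ge k : k.+1%:R <= tower k.
Proof.
elim: k => [//|k IH]; rewrite towerS (le_trans _ (expR_ge1Dx _))//.
by rewrite -natr1 addrC lerD2l.
Qed.

Lemma tower_ge1 k : 1 <= tower k.
Proof. by rewrite (le_trans _ (tower_ge k))// ler1n. Qed.

Lemma tower_gt0 k : 0 < tower k.
Proof. exact: lt_le_trans (tower_ge1 k). Qed.

Lemma towerS_ge k : 2 * tower k <= tower k.+1.
Proof. exact: expR_ge_double. Qed.

Lemma tower_le j k : (j <= k)%N -> tower j <= tower k.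
Proof.
elim: k => [|k IH]; first by rewrite leqn0 => /eqP ->.
rewrite leq_eqVlt => /predU1P[->//|/IH /le_trans]; apply.
by have := towerS_ge k; have := tower_gt0 k; lra.
Qed.

Lemma ln_iterS j x : iter j.+1 (@ln R) x = iter j (@ln R) (ln x).
Proof. by rewrite iterSr. Qed.

Lemma iter_ln_gt1 j x : (1 < iter j (@ln R) x) = (tower j < x).
Proof.
elim: j x => [//|j IH] x; rewrite ln_iterS IH towerS.
have [x0|x0] := ltP 0 x; first by rewrite -[x in RHS]lnK// ltr_expR.
rewrite ln0// ltNge (ltW (tower_gt0 _))/=; apply/esym/negbTE.
by rewrite -leNgt (le_trans x0)// expR_ge0.
Qed.

Lemma iter_ln_gt0 j x : 0 < iter j.+1 (@ln R) x -> 1 < iter j (@ln R) x.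
Proof. by rewrite iterS; apply: contraTT; rewrite -!leNgt => /ln_le0. Qed.

Lemma iter_ln_tower j k : iter j (@ln R) (tower (j + k)) = tower k.
Proof. by elim: j => [//|j IH]; rewrite ln_iterS addSn towerS expRK. Qed.

Lemma iter_ln_le j x y : x <= y -> 0 < iter j (@ln R) x ->
  iter j (@ln R) x <= iter j (@ln R) y.
Proof.
move=> xy; elim: j => [//|j IH] /[dup] gt0 /iter_ln_gt0 gt1.
have lt0 := lt_trans ltr01 gt1; have le := IH lt0.
by rewrite !iterS ler_ln// posrE// (lt_le_trans lt0).
Qed.

Lemma lprodS k x : lprod k.+1 x = lprod k x * iter k (@ln R) x.
Proof. by rewrite /lprod big_ord_recr. Qed.

Lemma lprodSl k x : lprod k.+1 x = x * lprod k (ln x).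
Proof.
by rewrite /lprod big_ord_recl/=; congr (_ * _); apply: eq_bigr => i _; rewrite -ln_iterS.
Qed.

Lemma ln_sub_le x y : 0 < x -> 0 < y -> ln x - ln y <= (x - y) / y.
Proof.
move=> x0 y0; rewrite -ln_div ?posrE//.
have := @le_ln1Dx R (x / y - 1); rewrite addrCA subrr addr0 mulrBl divff ?gt_eqF//.
by apply; rewrite ltrBrDr addNr divr_gt0.
Qed.

(** The product of the first k iterated logarithms is the reciprocal of the
    derivative of the next one; this is the mean value theorem for it, obtained
    by iterating the elementary bounds for one logarithm. *)
Lemma iter_ln_sub k x y : y <= x ->
  (forall j, (j < k)%N -> 0 < iter j (@ln R) y) ->
  (x - y) / lprod k x <= iter k (@ln R) x - iter k (@ln R) y
    <= (x - y) / lprod k y.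
Proof.
move=> yx; elim: k => [_|k IH gt0].
  by rewrite /lprod !big_ord0 !divr1 lexx.
have /andP[lo hi] := IH (fun j jk => gt0 j (ltnW jk)).
have gy := gt0 k (ltnSn k); have ge := iter_ln_le yx gy.
have gx := lt_le_trans gy ge.
rewrite !lprodS !invfM !mulrA !iterS; apply/andP; split.
  apply: (le_trans (ler_wpM2r _ lo)); first by rewrite invr_ge0 ltW.
  by rewrite -lerN2 opprB -mulNr opprB ln_sub_le.
apply: (le_trans (ln_sub_le gx gy)).
by rewrite ler_wpM2r// invr_ge0 ltW.
Qed.

(** Replacing the factors that do not exceed 1 by 1 leaves Psi unchanged, and in
    this form the number of factors can be taken arbitrarily large. *)
Lemma PsiE J N : N%:R <= tower J ->
  Psi R N = \prod_(j < J) Num.max 1 (iterlog R j N).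
Proof.
move=> le; rewrite (fsbig_ord _ J (fun j => Num.max 1 (iterlog R j N))).
rewrite /Psi -(@fsbig_widen _ _ _ _ [set k | 1 < iterlog R k N] `I_J); last 2 first.
- move=> j /=; rewrite /iterlog iter_ln_gt1 => lt.
  rewrite ltnNge; apply/negP => /tower_le Jj.
  by have := le_lt_trans Jj (lt_le_trans lt le); rewrite ltxx.
- by move=> j /= [_ /negP]; rewrite -leNgt => /max_idPl.
apply: eq_fsbigr => j; rewrite inE /= => gt1.
by rewrite max_r// ltW.
Qed.

Lemma Psi_bound n N : exists J, n%:R <= tower J /\ N%:R <= tower J.
Proof.
exists (maxn n N); split; rewrite (le_trans _ (tower_ge _))// ler_nat.
  by rewrite leqW// leq_maxl.
by rewrite leqW// leq_maxr.
Qed.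

Lemma le_Psi n N : (n <= N)%N -> Psi R n <= Psi R N.
Proof.
move=> nN; have [J [le1 le2]] := Psi_bound n N.
rewrite (PsiE le1) (PsiE le2); apply: ler_prod => j _.
apply/andP; split; first by rewrite (le_trans ler01)// le_max lexx.
rewrite ge_max le_max lexx/=.
have [le|lt] := leP (iterlog R j n) 1; first by rewrite le_max le.
by rewrite le_max iter_ln_le ?ler_nat ?(lt_trans ltr01 lt)// orbT.
Qed.

Lemma Psi_ge1 N : 1 <= Psi R N.
Proof.
have [J [_ le]] := Psi_bound 0 N; rewrite (PsiE le).
by elim/big_rec: _ => // i x _ x1; rewrite mulr_ege1// le_max lexx.
Qed.

Lemma Psi_gt0 N : 0 < Psi R N.
Proof. exact: lt_le_trans (Psi_ge1 N). Qed.

Lemma Psi_level k N : tower k < N%:R <= tower k.+1 -> Psi R N = lprod k.+1 N%:R.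
Proof.
move=> /andP[lt le]; rewrite (PsiE le); apply: eq_bigr => j _.
by rewrite max_r// ltW// iter_ln_gt1 (le_lt_trans _ lt)// tower_le// -ltnS.
Qed.

Lemma level_exists N : (1 < N)%N -> exists k, tower k < N%:R <= tower k.+1.
Proof.
move=> N1; have ex : exists k, N%:R <= tower k.
  by exists N; rewrite (le_trans _ (tower_ge _))// ler_nat.
case: (ex_minnP ex) => [[|k]] le min; first by move: le; rewrite /tower/= leNgt ltr1n N1.
exists k; rewrite le andbT ltNge; apply/negP => /min.
by rewrite ltnn.
Qed.

(** By induction the factors after x have a product of at most (ln x)^2 <= x. *)
Lemma lprod_le_sqr k x : 1 <= x -> (forall j, (j < k)%N -> 1 <= iter j (@ln R) x) ->
  lprod k x <= x ^+ 2.
Proof.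
elim: k x => [|k IH] x x1 ge1; first by rewrite /lprod big_ord0 expr_ge1// (le_trans ler01).
have x0 : 0 < x by exact: lt_le_trans x1.
rewrite lprodSl expr2 ler_wpM2l ?(ltW x0)//.
case: k IH ge1 => [_ _|k IH ge1]; first by rewrite /lprod big_ord0.
have lx1 : 1 <= ln x by exact: ge1 1%N isT.
rewrite (le_trans (IH _ lx1 _))//; first by move=> j jk; rewrite -ln_iterS ge1.
by rewrite -[leRHS]lnK// sqr_le_expR// (le_trans ler01).
Qed.

Lemma Psi_le_sqr N : (0 < N)%N -> Psi R N <= N%:R ^+ 2.
Proof.
case: N => // -[_|N _].
  by rewrite (@PsiE 0%N)// big_ord0 expr1n.
have [k lev] := @level_exists N.+2 isT; rewrite (Psi_level lev) lprod_le_sqr ?ler1n// => j jk.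
case/andP: lev => lt _.
by rewrite ltW// iter_ln_gt1 (le_lt_trans _ lt)// tower_le// -ltnS.
Qed.

Lemma Psi_ge k N : tower k.+1 < N%:R -> N%:R * tower k <= Psi R N.
Proof.
move=> lt; have N1 : (1 < N)%N.
  by rewrite -(ltr_nat R) (le_lt_trans (tower_ge1 _) lt).
have [J [_ le]] := Psi_bound 0 N.
have [j lev] := level_exists N1; rewrite (Psi_level lev).
have kj : (k < j)%N.
  rewrite ltnNge; apply/negP => jk.
  have /andP[_ le2] := lev; have := lt_le_trans lt le2.
  by rewrite ltNge tower_le.
rewrite lprodSl ler_wpM2l//.
case: j kj lev => // j _ /andP[ltj _].
have lnlt i : (i <= j)%N -> 1 < iter i (@ln R) (ln N%:R).
  move=> ij; rewrite -ln_iterS iter_ln_gt1.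
  by rewrite (le_lt_trans _ ltj)// tower_le.
rewrite lprodSl.
have : tower k < ln N%:R.
  by rewrite -ltr_expR -towerS lnK// posrE ltr0n ltnW.
move=> /ltW/le_trans; apply; rewrite ler_peMr//.
  exact: (ltW (lt_trans ltr01 (lnlt 0%N isT))).
rewrite /lprod; elim/big_rec: _ => // i x _ x1.
by rewrite mulr_ege1// -ln_iterS ltW// lnlt.
Qed.

Lemma Psi_ge_id N : N%:R <= Psi R N.
Proof.
case: N => [|[|N]]; [exact: le_trans (Psi_ge1 _)|exact: Psi_ge1|].
have [k lev] := @level_exists N.+2 isT; rewrite (Psi_level lev) lprodSl.
rewrite ler_peMr// /lprod; elim/big_ind: _ => // [x y x1 y1|i _].
  by rewrite mulr_ege1.
case/andP: lev => lt _.
by rewrite -ln_iterS ltW// iter_ln_gt1 (le_lt_trans _ lt)// tower_le.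
Qed.

End IteratedLog.

(** * Sums of 1/Psi over one level of the exponential tower *)

Section LevelSums.
Variable R : realType.
Implicit Types (x y : R) (j k n N : nat).

(** A bound for 1/Psi N that is uniform in the N >= n of level k. *)
Definition weight k n : R :=
  if n%:R <= tower R k then (tower R k)^-1 else (Psi R n)^-1.

Lemma weight_ge0 k n : 0 <= weight k n.
Proof. by rewrite /weight; case: ifP => _; rewrite invr_ge0 ltW// ?tower_gt0// Psi_gt0. Qed.

Lemma weight_ge k n N : (n <= N)%N -> tower R k < N%:R ->
  (Psi R N)^-1 <= weight k n.
Proof.
move=> nN lt; rewrite /weight; case: ifP => _; rewrite lef_pV2 ?posrE ?Psi_gt0 ?tower_gt0//.
  by rewrite (le_trans (ltW lt))// Psi_ge_id.
exact: le_Psi.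
Qed.

Lemma level_gt0 k x : tower R k <= x -> forall j, (j < k.+1)%N -> 0 < iter j (@ln R) x.
Proof.
move=> le j; rewrite ltnS => jk; move: le; rewrite -(subnKC jk) => le.
have t0 : 0 < iter j (@ln R) (tower R (j + (k - j))) by rewrite iter_ln_tower tower_gt0.
exact: lt_le_trans (iter_ln_le le t0).
Qed.

Lemma level_sub n k : tower R k < n%:R -> n.+1%:R <= tower R k.+1 ->
  (Psi R n.+1)^-1 <= iter k.+1 (@ln R) n.+1%:R - iter k.+1 (@ln R) n%:R <= (Psi R n)^-1.
Proof.
move=> lt le.
have nS : n%:R <= n.+1%:R :> R by rewrite ler_nat.
rewrite (@Psi_level _ k) ?le ?(lt_le_trans lt)//.
rewrite (@Psi_level _ k) ?lt ?(le_trans nS)//.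
have := iter_ln_sub nS (level_gt0 (ltW lt)).
have -> : n.+1%:R - n%:R = 1 :> R by rewrite -natr1 addrAC subrr add0r.
by rewrite !mul1r.
Qed.

(** On one level the sum of 1/Psi is dominated by the increments of an iterated
    logarithm that only runs from 0 to 1 there. *)
Lemma sum_weight k N : N%:R <= tower R k.+1 -> \sum_(1 <= n < N.+1) weight k n <= 3.
Proof.
move=> leN.
have t0 := tower_gt0 R k.
suff : (N%:R <= tower R k -> \sum_(1 <= n < N.+1) weight k n = N%:R / tower R k) /\
       (tower R k < N%:R -> \sum_(1 <= n < N.+1) weight k n <= 2 + iter k.+1 (@ln R) N%:R).
  move=> [h1 h2]; have [le|lt] := leP N%:R (tower R k).
    by rewrite h1// (@le_trans _ _ 1) ?ler1n// ler_pdivrMr// mul1r.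
  rewrite (le_trans (h2 _))//.
  have -> : 3%:R = 2%:R + 1 :> R by rewrite natr1.
  have top : iter k.+1 (@ln R) (tower R k.+1) = 1.
    by have := iter_ln_tower R k.+1 0; rewrite addn0.
  have pos : 0 < iter k.+1 (@ln R) N%:R by rewrite iterS ln_gt0// iter_ln_gt1.
  by have := iter_ln_le leN pos; rewrite top lerD2l.
elim: N leN => [_|N IH leN].
  by rewrite big_geq// mul0r; split=> // /(lt_trans t0); rewrite ltxx.
have NS : N%:R <= N.+1%:R :> R by rewrite ler_nat.
have [h1 h2] := IH (le_trans NS leN).
rewrite big_nat_recr//=; split=> [le|lt].
  by rewrite {2}/weight le h1 ?(le_trans NS)// -natr1 mulrDl mul1r.
have -> : weight k N.+1 = (Psi R N.+1)^-1 by rewrite /weight leNgt lt.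
have [le|gt] := leP N%:R (tower R k).
  rewrite h1//.
  have : N%:R / tower R k <= 1 by rewrite ler_pdivrMr// mul1r.
  have : (Psi R N.+1)^-1 <= 1 by rewrite invf_le1 ?Psi_gt0// Psi_ge1.
  have : 0 < iter k.+1 (@ln R) N.+1%:R by rewrite /= ln_gt0// iter_ln_gt1.
  by rewrite /=; lra.
have /andP[le _] := level_sub gt leN.
by have := h2 gt; move: le; rewrite /=; lra.
Qed.

Lemma level_sum_ge k a b : (a <= b)%N -> tower R k < a%:R -> b%:R <= tower R k.+1 ->
  iter k.+1 (@ln R) b%:R - iter k.+1 (@ln R) a%:R <= \sum_(a <= n < b) (Psi R n)^-1.
Proof.
elim: b => [|b IH].
  by rewrite leqn0 => /eqP -> _ _; rewrite subrr big_geq.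
rewrite leq_eqVlt => /predU1P[-> _ _|]; first by rewrite subrr big_geq.
rewrite ltnS => ab lt le; rewrite big_nat_recr//=.
have bS : b%:R <= b.+1%:R :> R by rewrite ler_nat.
have := IH ab lt (le_trans bS le).
have ltb : tower R k < b%:R by rewrite (lt_le_trans lt)// ler_nat.
have /andP[_] := level_sub ltb le.
by rewrite /=; lra.
Qed.

(** Over a level the iterated logarithm gains 1, of which rounding the end points
    to integers costs at most 1/3 each. *)
Lemma level_full_sum k a b : (2 <= k)%N ->
  tower R k < a%:R -> a%:R <= tower R k + 1 ->
  tower R k.+1 - 1 <= b%:R -> b%:R <= tower R k.+1 -> (a <= b)%N ->
  3^-1 <= \sum_(a <= n < b) (Psi R n)^-1.
Proof.
move=> k2 ta at1 tb1 bt ab.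
apply: le_trans (level_sum_ge ab ta bt).
have t0 := tower_gt0 R k.
have tb : tower R k < b%:R by rewrite (lt_le_trans ta)// ler_nat.
have t3 : 3 <= tower R k by rewrite (le_trans _ (tower_ge R k))// ler_nat.
have /andP[_ h1] := iter_ln_sub (ltW ta) (level_gt0 (lexx _)).
have /andP[_ h2] := iter_ln_sub bt (level_gt0 (ltW tb)).
have e0 : iter k.+1 (@ln R) (tower R k) = 0.
  by have := iter_ln_tower R k 0; rewrite addn0 iterS => ->; rewrite ln1.
have e1 : iter k.+1 (@ln R) (tower R k.+1) = 1.
  by have := iter_ln_tower R k.+1 0; rewrite addn0.
rewrite e0 in h1; rewrite e1 in h2.
have key (u w : R) : 0 <= u <= 1 -> tower R k <= w -> 
    (forall j, (j < k.+1)%N -> 1 <= iter j (@ln R) w) -> u / lprod k.+1 w <= 3^-1.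
  move=> /andP[u0 u1] tw g1.
  have w0 : 0 < w by exact: lt_le_trans tw.
  have l3 : 3 <= lprod k.+1 w.
    rewrite lprodSl (le_trans (le_trans t3 tw))// ler_peMr ?(ltW w0)//.
    rewrite /lprod; elim/big_rec: _ => // i x _ x1.
    by rewrite mulr_ege1// -ln_iterS g1 ?ltnS.
  have l0 : 0 < lprod k.+1 w by apply: lt_le_trans l3.
  rewrite ler_pdivrMr// (le_trans u1)// -ler_pdivrMl ?invr_gt0// invrK mulr1//.
have g1 w : tower R k <= w -> forall j, (j < k.+1)%N -> 1 <= iter j (@ln R) w.
  move=> le j; rewrite ltnS => jk; move: le; rewrite -(subnKC jk) => le.
  have t0' : 0 < iter j (@ln R) (tower R (j + (k - j))) by rewrite iter_ln_tower tower_gt0.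
  by apply: le_trans (iter_ln_le le t0'); rewrite iter_ln_tower tower_ge1.
have k1 : (a%:R - tower R k) / lprod k.+1 (tower R k) <= 3^-1.
  by apply: key => //; [lra|exact: g1].
have k2' : (tower R k.+1 - b%:R) / lprod k.+1 b%:R <= 3^-1.
  by apply: key => //; [lra|exact: ltW|exact/g1/ltW].
by lra.
Qed.

(** Cutting a level [t, exp t] at exp (theta t) makes both parts so short that the
    logarithm of the right end is at most theta times the left end, and one of
    them carries half of the sum over the level. *)
Lemma short_interval (theta : R) A : 0 < theta -> exists a b,
  [/\ (A <= a)%N, (0 < a <= b)%N, ln b%:R <= theta * a%:R &
      6^-1 <= \sum_(a <= n < b) (Psi R n)^-1].
Proof.
wlog th1 : theta / theta <= 1.
  move=> H th0; have [le|gt] := leP theta 1; first exact: H.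
  have [a [b [Aa ab le sum]]] := H 1 (lexx _) ltr01.
  exists a, b; split=> //; rewrite (le_trans le)// ler_wpM2r//.
  exact: ltW.
move=> th0.
pose k := maxn (maxn A 2) (Num.trunc (4 / theta ^+ 3)).+1.
have Ak : (A <= k)%N by rewrite /k !leq_max leqnn.
have k2 : (2 <= k)%N by rewrite /k !leq_max leqnn orbT.
set t := tower R k.
have tk : k.+1%:R <= t := tower_ge R k.
have t3 : 3 <= t by rewrite (le_trans _ tk)// ler_nat.
have t0 : 0 < t by exact: tower_gt0.
(* This makes exp (theta t) >= (theta t)^2 exceed both t / theta and t + 1. *)
have tth : 4 <= t * theta ^+ 3.
  rewrite -ler_pdivrMr ?exprn_gt0//.
  rewrite (le_trans (ltW (truncnS_gt _)))// (le_trans _ tk)// ler_nat.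
  by rewrite /k leqW// leq_maxr.
have e2 : (theta * t) ^+ 2 <= expR (theta * t) by rewrite sqr_le_expR// mulr_ge0// ltW.
have q1 : 4 * t <= theta * (theta * t) ^+ 2.
  have -> : theta * (theta * t) ^+ 2 = (t * theta ^+ 3) * t by ring.
  by rewrite ler_wpM2r// ltW.
pose a0 := (Num.trunc t).+1.
pose m := Num.trunc (expR (theta * t)).
pose b0 := Num.trunc (tower R k.+1).
have /andP[ta _] := truncn_itv (ltW t0).
have ta0 : t < a0%:R by exact: truncnS_gt.
have at1 : a0%:R <= t + 1 by rewrite /a0 -natr1 lerD2r.
have /andP[me em] := truncn_itv (expR_ge0 (theta * t)).
have /andP[be eb] := truncn_itv (ltW (tower_gt0 R k.+1)).
rewrite -/m in me em; rewrite -/b0 in be eb.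
rewrite -natr1 in em; rewrite -natr1 in eb.
have thm : t <= theta * m%:R.
  have h : (theta * t) ^+ 2 - 1 <= m%:R by lra.
  apply: le_trans (ler_wpM2l (ltW th0) h).
  by rewrite mulrBr mulr1; lra.
have mle : theta * m%:R <= m%:R by rewrite ler_piMl.
have q2 : theta * (theta * t) ^+ 2 <= (theta * t) ^+ 2 by rewrite ler_piMl ?sqr_ge0.
have am : (a0 <= m)%N by rewrite -(ler_nat R); lra.
have mb : (m <= b0)%N.
  by rewrite le_truncn// ler_expR ler_piMl// ltW.
have full := level_full_sum k2 ta0 at1.
have {full} : 3^-1 <= \sum_(a0 <= n < b0) (Psi R n)^-1.
  apply: full => //; [lra|exact: leq_trans am mb].
have Aa : (A <= a0)%N.
  rewrite (leq_trans Ak)// -ltnS -(ltr_nat R) (le_lt_trans _ (lt_trans ta0 _))//.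
    by rewrite (le_trans _ tk)// ler_nat.
  by rewrite ltr_nat.
have lnexp (n : nat) (u : R) : (0 < n)%N -> n%:R <= expR u -> ln n%:R <= u.
  by move=> n0 le; rewrite -[u]expRK ler_ln ?posrE ?expR_gt0 ?ltr0n.
rewrite (big_cat_nat am mb)/= => full.
have [h|h] := leP 6^-1 (\sum_(a0 <= n < m) (Psi R n)^-1).
  exists a0, m; split=> //.
  rewrite (le_trans (lnexp _ _ _ me)) ?(leq_trans _ am)//.
  by rewrite ler_wpM2l// ltW.
exists m, b0; split=> //.
- exact: leq_trans Aa am.
- by rewrite mb (leq_trans _ am).
- by rewrite (le_trans (lnexp _ _ _ be)) ?(leq_trans _ (leq_trans am mb)).
- by lra.
Qed.

End LevelSums.

(** * Binary digits *)

Section BinaryDigits.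
Implicit Types (l h m n z K : nat).

Definition bit n z : bool := odd (z %/ 2 ^ n).

Lemma bit_le n z : bit n z -> (2 ^ n <= z)%N.
Proof. by rewrite /bit; case: ltnP => // lt; rewrite divn_small. Qed.

(** There is no borrow, so that exactly one digit is cleared. *)
Lemma bit_sub m n z : bit n z -> bit m (z - 2 ^ n) = (m != n) && bit m z.
Proof.
move=> bnz; have le := bit_le bnz.
case: (ltngtP m n) => [mn|nm|->] /=.
- have -> : bit m z = bit m ((z - 2 ^ n) + 2 ^ (n - m) * 2 ^ m).
    by rewrite -expnD subnK ?(ltnW mn)// subnK.
  by rewrite /bit divnDMl ?expn_gt0// oddD oddX/= subn_eq0 leqNgt mn addbF.
- have key w : (w %/ 2 ^ m = (w %/ 2 ^ n)./2 %/ 2 ^ (m - n.+1))%N.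
    by rewrite -divn2 -!divnMA -expnS -expnD -subSn// subSS subnKC// ltnW.
  rewrite /bit !key; congr (odd (_ %/ _)).
  have : (z %/ 2 ^ n = ((z - 2 ^ n) %/ 2 ^ n).+1)%N.
    by rewrite -{1}(subnK le) -{2}[(2 ^ n)%N]mul1n divnDMl ?expn_gt0// addn1.
  move: bnz; rewrite /bit => /[swap] -> /=.
  by rewrite uphalf_half => /negbTE ->.
- move: bnz; rewrite /bit -{1}(subnK le) -{2}[(2 ^ n)%N]mul1n divnDMl ?expn_gt0//.
  by rewrite addn1/= => /negbTE.
Qed.

Lemma bit_mod n z K : (n < K)%N -> bit n (z %% 2 ^ K) = bit n z.
Proof.
move=> nK; rewrite {2}(divn_eq z (2 ^ K)) /bit.
have -> : (2 ^ K = 2 ^ (K - n) * 2 ^ n)%N by rewrite -expnD subnK// ltnW.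
rewrite mulnA divnMDl ?expn_gt0// oddD oddM oddX/= subn_eq0 leqNgt nK.
by rewrite andbF.
Qed.

Lemma bit_add n z K : (n < K)%N -> bit n (z + 2 ^ K) = bit n z.
Proof.
by move=> nK; rewrite -(bit_mod _ nK) modnDr bit_mod.
Qed.

Lemma bit_top z K : (z < 2 ^ K)%N -> bit K z = false.
Proof. by move=> lt; rewrite /bit divn_small. Qed.

Lemma bit_top_add z K : (z < 2 ^ K)%N -> bit K (z + 2 ^ K) = true.
Proof.
by move=> lt; rewrite /bit -{1}[(2 ^ K)%N]mul1n divnDMl ?expn_gt0// divn_small.
Qed.

Definition ones l h z : nat := (\sum_(l <= n < h) bit n z)%N.

Lemma ones_sub l h n z : bit n z ->
  ones l h z = (ones l h (z - 2 ^ n) + (l <= n < h))%N.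
Proof.
move=> bnz; rewrite /ones.
have -> : (l <= n < h)%N = (\sum_(l <= m < h) (m == n))%N :> nat.
  case: (boolP (l <= n < h)%N) => nlh.
    rewrite (bigD1_seq n) ?iota_uniq ?mem_index_iota//= eqxx big1// => i /negbTE ->//.
  rewrite big_nat big1// => i ilh; case: eqP => // ein.
  by rewrite -ein ilh in nlh.
rewrite -big_split/=; apply: eq_bigr => m _; rewrite bit_sub//.
by case: eqP => [->|]; rewrite ?bnz ?addn0.
Qed.

Lemma ones_mod l h z K : (h <= K)%N -> ones l h (z %% 2 ^ K) = ones l h z.
Proof.
move=> hK; rewrite /ones big_nat [in RHS]big_nat; apply: eq_bigr => n /andP[_ nh].
by rewrite bit_mod// (leq_trans nh).
Qed.

Lemma sum_shift_mod (V : nmodType) (Q w : nat) (F : nat -> V) :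
  \sum_(0 <= u < Q) F ((w + u) %% Q)%N = \sum_(0 <= u < Q) F u.
Proof.
case: Q => [|Q]; first by rewrite !big_geq.
elim: w => [|w IH].
  by rewrite big_nat [RHS]big_nat; apply: eq_bigr => i /andP[_ iQ]; rewrite add0n modn_small.
rewrite -IH big_nat_recr//= [in RHS]big_nat_recl//= addrC; congr (_ + _).
  by rewrite addSnnS modnDr addn0.
by apply: eq_bigr => i _; rewrite addSnnS.
Qed.

End BinaryDigits.

Section DigitConcentration.
Variable R : realType.

(** Distinct binary digits of a uniform number below a power of two are
    independent, hence their signs are orthogonal. *)
Lemma sum_sqr_signs (c : nat -> R) K :
  \sum_(0 <= z < 2 ^ K) (\sum_(0 <= n < K) c n * (-1) ^+ bit n z) ^+ 2
  = (2 ^ K)%:R * \sum_(0 <= n < K) c n ^+ 2.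
Proof.
elim: K => [|K IH]; first by rewrite big_nat1 !big_geq// expr0n mulr0.
rewrite expnS mul2n -addnn (@big_cat_nat _ _ _ (2 ^ K))/= ?leq_addr//.
rewrite -{2}[(2 ^ K)%N]add0n big_addn addnK -big_split/=.
transitivity (\sum_(0 <= z < 2 ^ K) (2 * (\sum_(0 <= n < K) c n * (-1) ^+ bit n z) ^+ 2
                + 2 * c K ^+ 2)).
  rewrite big_nat [RHS]big_nat; apply: eq_bigr => z /andP[_ lt].
  rewrite !big_nat_recr//= bit_top// bit_top_add// expr0 expr1.
  have -> : \sum_(0 <= n < K) c n * (-1) ^+ bit n (z + 2 ^ K) =
            \sum_(0 <= n < K) c n * (-1) ^+ bit n z.
    by rewrite big_nat [RHS]big_nat; apply: eq_bigr => n /andP[_ nK]; rewrite bit_add.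
  by ring.
rewrite big_split/= -mulr_sumr IH big_const_nat subn0 iter_addr_0 big_nat_recr//=.
by rewrite -mulr_natr natrD; ring.
Qed.

(** Chebyshev's inequality for the number of digits 1 in a window. *)
Lemma few_ones l h K : (l <= h <= K)%N ->
  (h - l)%:R * \sum_(0 <= z < 2 ^ K) (4 * ones l h z < h - l)%N%:R <= 4 * (2 ^ K)%:R :> R.
Proof.
move=> /andP[lh hK].
have [->|lh'] := eqVneq l h; first by rewrite subnn mul0r mulr_ge0.
have m0 : 0 < (h - l)%:R :> R by rewrite ltr0n subn_gt0 ltn_neqAle lh' lh.
pose c n : R := (l <= n < h)%N%:R.
have win (F : nat -> R) : \sum_(0 <= n < K) c n * F n = \sum_(l <= n < h) F n.
  rewrite (@big_cat_nat _ _ _ l 0 K)//=; last exact: leq_trans hK.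
  rewrite [X in X + _ = _]big1_seq ?add0r; last first.
    move=> i; rewrite mem_index_iota => /andP[_ /andP[_ il]].
    by rewrite /c leqNgt il mul0r.
  rewrite (@big_cat_nat _ _ _ h l K)//= [X in _ + X = _]big1_seq ?addr0; last first.
    move=> i; rewrite mem_index_iota => /andP[_ /andP[hi _]].
    by rewrite /c [(i < h)%N]ltnNge hi andbF mul0r.
  rewrite big_nat [RHS]big_nat; apply: eq_bigr => i lih.
  by rewrite /c lih mul1r.
have := sum_sqr_signs c K.
have -> : \sum_(0 <= n < K) c n ^+ 2 = (h - l)%:R.
  under eq_bigr do rewrite expr2.
  rewrite win big_nat (eq_bigr (fun=> 1)) => [|i lih]; last by rewrite /c lih.
  by rewrite -big_nat big_const_nat iter_addr_0.
move=> E.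
rewrite -(ler_pM2l m0) mulrA -expr2 [leRHS]mulrCA [X in _ <= 4 * X]mulrC.
rewrite -E !mulr_sumr; apply: ler_sum => z _.
case: ltnP => [few|_]; last by rewrite mulr0 mulr_ge0// sqr_ge0.
rewrite mulr1 win.
have -> : \sum_(l <= n < h) (-1) ^+ bit n z = (h - l)%:R - 2 * (ones l h z)%:R :> R.
  rewrite /ones natr_sum mulr_sumr -[(h - l)%:R](_ : \sum_(l <= n < h) 1 = _); last first.
    by rewrite big_const_nat iter_addr_0.
  rewrite -sumrB; apply: eq_bigr => n _.
  by case: (bit n z) => /=; rewrite ?expr0 ?expr1; lra.
have : 4 * (ones l h z)%:R < (h - l)%:R :> R by rewrite -natrM ltr_nat.
have : 0 <= (ones l h z)%:R :> R by [].
set w := (ones l h z)%:R; set m := (h - l)%:R => w0 wm.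
have -> : 4 * (m - 2 * w) ^+ 2 = (2 * m - 4 * w) ^+ 2 by ring.
by rewrite ler_pXn2r// ?nnegrE; lra.
Qed.

End DigitConcentration.

(** * A perfect code with windows of length proportional to Psi *)

Section SyndromeCode.
Variables (q : nat) (e : nat -> nat).
Implicit Types (c g n u z K : nat).

(** Digits in the g-th window [e g, e g.+1) have g as their column in the
    parity-check matrix over the integers modulo q. *)
Definition syndrome z : nat := (\sum_(0 <= g < q) g * ones (e g) (e g.+1) z)%N.

(** The window that serves the integer n after the offset u and the translation
    of the syndrome by c; the code itself is [slot u c n = 0]. *)
Definition slot u c n : nat := (syndrome (n + u) + c) %% q.

Hypothesis e_homo : {homo e : g h / (g <= h)%N}.

Lemma syndrome_sub g n z : (g < q)%N -> (e g <= n < e g.+1)%N -> bit n z ->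
  syndrome z = (syndrome (z - 2 ^ n) + g)%N.
Proof.
move=> gq ng bnz; rewrite /syndrome.
rewrite (bigD1_seq g) ?iota_uniq ?mem_index_iota//=.
rewrite [in RHS](bigD1_seq g) ?iota_uniq ?mem_index_iota//=.
rewrite (ones_sub _ _ bnz) ng mulnDr muln1 addnAC; congr (_ + _ + _)%N.
apply: eq_bigr => h hg; rewrite (ones_sub _ _ bnz).
suff -> : (e h <= n < e h.+1)%N = false by rewrite addn0.
apply/negbTE/negP => /andP[h1 h2]; case/andP: ng => g1 g2.
move: hg; rewrite neq_ltn => /orP[lt|lt].
  by have := leq_ltn_trans (leq_trans (e_homo lt) g1) h2; rewrite ltnn.
by have := leq_ltn_trans (leq_trans (e_homo lt) h1) g2; rewrite ltnn.
Qed.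

(** A digit 1 in the window of the current slot is a move onto the code. *)
Lemma slot_hit u c n m : (0 < q)%N ->
  (e (slot u c n) <= m < e (slot u c n).+1)%N -> bit m (n + u) -> (2 ^ m <= n)%N ->
  slot u c (n - 2 ^ m) = 0%N.
Proof.
move=> q0 mg b le; have gq : (slot u c n < q)%N by rewrite ltn_mod.
have E := syndrome_sub gq mg b.
have : (syndrome (n - 2 ^ m + u) + c + slot u c n = 0 + slot u c n %[mod q])%N.
  by rewrite addnAC addnBAC// -E add0n /slot modn_mod.
by move=> /eqP; rewrite eqn_modDr mod0n => /eqP.
Qed.

End SyndromeCode.

Section CodeCount.
Variables (R : realType) (q : nat) (e : nat -> nat) (K : nat).
Hypothesis e_homo : {homo e : g h / (g <= h)%N}.
Hypothesis qK : (e q <= K)%N.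
Hypothesis q0 : (0 < q)%N.

(** For a fixed offset the slot runs through all residues as c varies. *)
Lemma count_code n :
  \sum_(0 <= u < 2 ^ K) \sum_(0 <= c < q) (slot q e u c n == 0%N)%:R = (2 ^ K)%:R :> R.
Proof.
rewrite (eq_bigr (fun=> 1)) ?big_const_nat ?iter_addr_0 ?subn0// => u _.
rewrite (sum_shift_mod q (syndrome q e (n + u)) (fun g => (g == 0%N)%:R)).
rewrite (bigD1_seq 0%N) ?iota_uniq ?mem_index_iota//= big1 ?addr0// => g.
by move=> /negbTE ->.
Qed.

Variable (bad : pred nat).

(** The serving window is unusable or contains too few digits 1. *)
Definition failing u c n := let g := slot q e u c n in
  bad g || (4 * ones (e g) (e g.+1) (n + u) < e g.+1 - e g)%N.

Lemma count_failing (eps : R) n : 0 < eps ->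
  (forall g, (g < q)%N -> 4 / eps <= (e g.+1 - e g)%:R) ->
  \sum_(0 <= g < q) (bad g)%:R <= eps * q%:R ->
  \sum_(0 <= u < 2 ^ K) \sum_(0 <= c < q) (failing u c n)%:R
    <= 2 * eps * q%:R * (2 ^ K)%:R :> R.
Proof.
move=> eps0 wide few.
pose F g z : R := (bad g || (4 * ones (e g) (e g.+1) z < e g.+1 - e g)%N)%:R.
have -> : \sum_(0 <= u < 2 ^ K) \sum_(0 <= c < q) (failing u c n)%:R =
          \sum_(0 <= g < q) \sum_(0 <= z < 2 ^ K) F g z.
  transitivity (\sum_(0 <= u < 2 ^ K) \sum_(0 <= g < q) F g (n + u)%N).
    by apply: eq_bigr => u _; rewrite -(sum_shift_mod q (syndrome q e (n + u)) (fun g => F g (n + u)%N)).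
  rewrite exchange_big_nat/= big_nat [RHS]big_nat; apply: eq_bigr => g /andP[_ gq].
  rewrite -(sum_shift_mod (2 ^ K) n (F g)); apply: eq_bigr => u _.
  by rewrite /F ones_mod// (leq_trans _ qK)// e_homo.
have key g : (g < q)%N ->
    \sum_(0 <= z < 2 ^ K) F g z <= (bad g)%:R * (2 ^ K)%:R + eps * (2 ^ K)%:R.
  move=> gq; have gK : (e g <= e g.+1 <= K)%N.
    by rewrite e_homo//= (leq_trans _ qK)// e_homo.
  have := few_ones R gK; set s := (X in _ * X <= _ -> _) => few1.
  have le1 : s <= eps * (2 ^ K)%:R.
    have w0 := wide g gq.
    have m0 : 0 < (e g.+1 - e g)%:R :> R by rewrite (lt_le_trans _ w0)// divr_gt0.
    rewrite -(ler_pM2l m0) (le_trans few1)// mulrA ler_wpM2r//.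
    by move: w0; rewrite ler_pdivrMr.
  apply: le_trans (lerD (lexx _) le1).
  rewrite -[X in (bad g)%:R * X](_ : \sum_(0 <= z < 2 ^ K) 1 = _); last first.
    by rewrite big_const_nat subn0 iter_addr_0.
  rewrite mulr_sumr -big_split/=; apply: ler_sum => z _; rewrite /F mulr1.
  by case: (bad g); case: (_ < _)%N; rewrite /= ?addr0 ?add0r// lerDl.
rewrite big_nat (le_trans (ler_sum _ (fun g hg => key g (proj2 (andP hg)))))//.
rewrite -big_nat big_split/= -mulr_suml big_const_nat subn0 iter_addr_0 -[(eps * _) *+ q]mulr_natr.
have := ler_wpM2r (ler0n R (2 ^ K)%N) few.
set Q := (2 ^ K)%:R; set qq := q%:R; move=> h.
have -> : 2 * eps * qq * Q = eps * qq * Q + eps * Q * qq by ring.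
by rewrite lerD2r.
Qed.

End CodeCount.

Section Windows.
Variable R : realType.

Definition window_step q n : nat := (Num.trunc (Psi R n / (8 * q%:R))).+1.

Definition window q a g : nat := iter g (fun n => (n + window_step q n)%N) a.

Definition doubling q a g : bool := 2 * Psi R (window q a g) < Psi R (window q a g.+1).

Lemma windowS q a g : window q a g.+1 = (window q a g + window_step q (window q a g))%N.
Proof. by []. Qed.

Lemma window_homo q a : {homo window q a : g h / (g <= h)%N}.
Proof. by apply: homo_leq; [exact: leqnn|exact: leq_trans|move=> g; rewrite windowS leq_addr]. Qed.

Lemma window_stepP q n : (0 < q)%N ->
  Psi R n / (8 * q%:R) <= (window_step q n)%:R <= Psi R n / (8 * q%:R) + 1.
Proof.
move=> q0; rewrite /window_step ltW ?truncnS_gt//= -natr1 lerD2r truncn_le.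
by rewrite divr_ge0 ?mulr_ge0// ltW// Psi_gt0.
Qed.

(** The lengths of the windows are proportional to Psi up to rounding, so each of
    them takes the same small share of the sum of 1/Psi. *)
Lemma window_sum q a g : (0 < q)%N ->
  \sum_(a <= n < window q a g) (Psi R n)^-1
    <= g%:R * ((8 * q%:R)^-1 + (Psi R a)^-1).
Proof.
move=> q0; elim: g => [|g IH]; first by rewrite big_geq// mul0r.
have ag : (a <= window q a g)%N by rewrite -{1}[a]/(window q a 0) window_homo.
rewrite (big_cat_nat ag (window_homo _ _ (leqnSn _)))/= -natr1 mulrDl mul1r lerD//.
set w := window q a g.
apply: (@le_trans _ _ (\sum_(w <= n < window q a g.+1) (Psi R w)^-1)).
  rewrite big_nat [leRHS]big_nat; apply: ler_sum => n /andP[wn _].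
  by rewrite lef_pV2 ?posrE ?Psi_gt0// le_Psi.
rewrite big_const_nat iter_addr_0 windowS addKn -/w -[_ *+ window_step q w]mulr_natl.
have /andP[_ le] := window_stepP w q0.
have P0 := Psi_gt0 R w.
apply: (@le_trans _ _ ((Psi R w / (8 * q%:R) + 1) / Psi R w)).
  by rewrite ler_wpM2r// invr_ge0 ltW.
rewrite mulrDl mul1r mulrAC divff ?gt_eqF// mul1r lerD2l.
by rewrite lef_pV2 ?posrE ?Psi_gt0// le_Psi.
Qed.

(** Psi is at most quadratic, so it doubles only logarithmically often. *)
Lemma count_doubling q a g : (0 < a)%N ->
  \sum_(0 <= h < g) (doubling q a h)%:R <= 4 * ln (window q a g)%:R :> R.
Proof.
move=> a0; set b := window q a g.
have b0 : (0 < b)%N by rewrite (leq_trans a0)// -{1}[a]/(window q a 0) window_homo.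
pose s g := (\sum_(0 <= h < g) doubling q a h)%N.
have pow k : 2 ^+ s k <= Psi R (window q a k).
  elim: k => [|k IH]; first by rewrite /s big_geq// expr0 Psi_ge1.
  rewrite /s big_nat_recr//= -/(s k) exprD.
  have mono := le_Psi R (window_homo q a (leqnSn k)).
  case: (boolP (doubling q a k)) => [dbl|_]; last by rewrite expr0 mulr1 (le_trans IH).
  by rewrite expr1 mulrC (le_trans _ (ltW dbl))// ler_wpM2l.
have sqr := le_trans (pow g) (Psi_le_sqr R b0).
have b0' : 0 < b%:R :> R by rewrite ltr0n.
have : ln (2 ^+ s g) <= ln (b%:R ^+ 2) :> R by rewrite ler_ln ?posrE ?exprn_gt0.
rewrite lnXn// lnXn// -[ln 2 *+ _]mulr_natl -[ln b%:R *+ _]mulr_natl => h.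
have ln2 : 2^-1 <= ln (2 : R).
  have := @ln_sub_le R 1 2 (@ltr01 R) (ltr0Sn R 1); rewrite ln1 sub0r.
  have -> : (1 - 2) / 2 = - 2^-1 :> R by field.
  by rewrite lerN2.
rewrite -natr_sum -/(s g); clear -h ln2.
have : (s g)%:R * 2^-1 <= (s g)%:R * ln (2 : R) by rewrite ler_wpM2l.
by move: h; set x := (s g)%:R; set y := ln b%:R; set z := x * ln 2; lra.
Qed.

(** The sum of 1/Psi over the range [a, b) exceeds the total share of q windows,
    so the windows end before b; as ln b is tiny compared to a, hence to q, few of
    the windows are [doubling]. *)
Lemma good_windows (eps : R) A : 0 < eps <= 1 -> exists q a,
  [/\ (0 < q)%N, (A <= a)%N, (0 < a)%N,
      forall g, 32 / eps <= (window q a g.+1 - window q a g)%:R &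
      \sum_(0 <= g < q) (doubling q a g)%:R <= eps / 8 * q%:R].
Proof.
move=> /andP[eps0 eps1].
have th0 : 0 < (eps / 128) ^+ 2 by rewrite exprn_gt0// divr_gt0// ltr0n.
have [a [b [Aa /andP[a0 ab] lnb sum]]] :=
  short_interval (maxn A (Num.trunc (512 / eps)).+1) th0.
have big : 512 <= a%:R * eps.
  rewrite -ler_pdivrMr// (le_trans (ltW (truncnS_gt _)))// ler_nat.
  by rewrite (leq_trans _ Aa)// leq_maxr.
(* For this q the windows have length at least 32 / eps, and rounding their
   lengths up costs at most q / Psi a <= 1 / 256 of the sum. *)
pose q := Num.trunc (a%:R * eps / 256).
have aeps0 : 0 <= a%:R * eps / 256 by rewrite divr_ge0// mulr_ge0// ltW.
have /andP[q_le q_lt] := truncn_itv aeps0; rewrite -/q -[q.+1%:R]natr1 in q_le q_lt.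
have q_ge : a%:R * eps / 512 <= q%:R by lra.
have q0 : (0 < q)%N by rewrite -(ltr0n R); lra.
have a0' : 0 < a%:R :> R by rewrite ltr0n.
have Pa := Psi_ge_id R a.
exists q, a; split=> //; first by rewrite (leq_trans _ Aa)// leq_maxl.
  move=> g; rewrite windowS addKn.
  have /andP[le _] := window_stepP (window q a g) q0; apply: le_trans le.
  have q0' : 0 < q%:R :> R by rewrite ltr0n.
  rewrite ler_pdivlMr ?mulr_gt0// mulrAC ler_pdivrMr//.
  have wa : (a <= window q a g)%N by rewrite -{1}[a]/(window q a 0) window_homo.
  have : a%:R * eps <= Psi R (window q a g) * eps.
    by rewrite ler_wpM2r ?(ltW eps0)// (le_trans Pa)// le_Psi.
  by lra.
rewrite (le_trans (count_doubling q q a0))//.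
have wb : (window q a q <= b)%N.
  rewrite leqNgt; apply/negP => bw.
  have h1 := window_sum a q q0.
  have h2 : 6^-1 <= \sum_(a <= n < window q a q) (Psi R n)^-1.
    apply: (le_trans sum); rewrite (big_cat_nat ab (ltnW bw))/= lerDl.
    by apply: sumr_ge0 => n _; rewrite invr_ge0 ltW// Psi_gt0.
  have q0' : 0 < q%:R :> R by rewrite ltr0n.
  have e1 : q%:R * ((8 * q%:R)^-1 + (Psi R a)^-1) = 8^-1 + q%:R / Psi R a.
    by rewrite mulrDr invfM mulrCA divff ?gt_eqF// mulr1.
  have : q%:R / Psi R a <= 256^-1.
    rewrite ler_pdivrMr ?Psi_gt0// (le_trans q_le)// mulrC ler_wpM2l//.
    by rewrite (le_trans _ Pa)// ler_piMr// ltW.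
  by lra.
have lnw : ln (window q a q)%:R <= ln b%:R :> R.
  have w0 : (0 < window q a q)%N by rewrite (leq_trans a0)// -{1}[a]/(window q a 0) window_homo.
  by rewrite ler_ln ?posrE ?ltr0n ?(leq_trans w0)// ler_nat.
have : eps * (a%:R * eps / 512) <= eps * q%:R by rewrite ler_wpM2l// ltW.
have -> : eps * (a%:R * eps / 512) = (eps / 128) ^+ 2 * a%:R * 32 by field.
by lra.
Qed.

End Windows.

(** * Recurrence and sweeping out *)

Section Recurrence.
Context (d : measure_display) (X : measurableType d) (R : realType).
Variable mu : probability X R.
Implicit Types (T : X -> X) (A B C E W : set X).

Lemma measurable_iter T n A : measure_preserving mu T ->
  measurable A -> measurable (iter n T @^-1` A).
Proof.
move=> [mT _]; elim: n A => [//|n IH] A mA.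
have -> : iter n.+1 T @^-1` A = iter n T @^-1` (T @^-1` A) by [].
by apply: IH; rewrite -[X in measurable X]setTI; exact: mT.
Qed.

Lemma measure_iter T n A : measure_preserving mu T ->
  measurable A -> mu (iter n T @^-1` A) = mu A.
Proof.
move=> mpT; elim: n A => [//|n IH] A mA.
have -> : iter n.+1 T @^-1` A = iter n T @^-1` (T @^-1` A) by [].
rewrite IH; last exact: (measurable_iter 1 mpT mA).
by rewrite mpT.2.
Qed.

Lemma negligible_iter T n A : measure_preserving mu T ->
  mu.-negligible A -> mu.-negligible (iter n T @^-1` A).
Proof.
move=> mpT [B [mB B0 AB]]; exists (iter n T @^-1` B); split.
- exact: measurable_iter.
- by rewrite measure_iter.
- by move=> x; exact: AB.
Qed.

Definition late_return T N A :=
  forall i x, (0 < i <= N)%N -> A x -> ~ A (iter i T x).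

(** A set whose first N preimages are disjoint from it has N + 1 pairwise
    disjoint preimages of equal measure. *)
Lemma late_return_le T N A : measure_preserving mu T -> measurable A ->
  late_return T N A -> (N.+1%:R%:E * mu A <= 1)%E.
Proof.
move=> mpT mA sep.
pose F i : set X := if (i < N.+1)%N then iter i T @^-1` A else set0.
have mF i : measurable (F i) by rewrite /F; case: ifP => // _; exact: measurable_iter.
have tF : trivIset setT F.
  apply: ltn_trivIset => j i ij; rewrite -subset0 => x; rewrite /F.
  case: (ltnP j N.+1) => jN; last by case=> [[]] || case=> _ [].
  rewrite (ltn_trans ij jN) => -[/= Ai Aj].
  apply: (sep (j - i)%N _ _ Ai); first by rewrite subn_gt0 ij/= (leq_trans (leq_subr _ _)).
  by rewrite -iterD subnK// ltnW.
have := measure_bigsetU mu mF tF N.+1.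
rewrite (eq_bigr (fun=> mu A)); last first.
  by move=> i _; rewrite /F ltn_ord/= measure_iter.
have fin : mu A \is a fin_num by rewrite fin_num_measure.
rewrite -(fineK fin) sumEFin sumr_const card_ord -[fine _ *+ _]mulr_natl EFinM => <-.
by apply: probability_le1; apply: bigsetU_measurable => i _; exact: mF.
Qed.

Definition recurrent T A : set X := lim_sup_set (fun n => iter n T @^-1` A).

Lemma recurrentP T A x :
  recurrent T A x <-> forall m, exists2 n, (m <= n)%N & A (iter n T x).
Proof.
split=> [rec m|rec m _]; first by have [n /= mn An] := rec m I; exists n.
by have [n mn An] := rec m; exists n.
Qed.

Lemma recurrent_iter T A j x : recurrent T A (iter j T x) <-> recurrent T A x.
Proof.
rewrite !recurrentP; split=> rec m.
  have [n mn An] := rec m; exists (n + j)%N; last by rewrite iterD.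
  by rewrite (leq_trans mn)// leq_addr.
have [n mn An] := rec (m + j)%N.
have jn : (j <= n)%N by rewrite (leq_trans _ mn)// leq_addl.
by exists (n - j)%N; rewrite ?leq_subRL ?(addnC j)// -iterD subnK.
Qed.

Lemma measurable_recurrent T A : measure_preserving mu T -> measurable A ->
  measurable (recurrent T A).
Proof.
move=> mpT mA; apply: bigcapT_measurable => m.
by apply: bigcup_measurable => n _; exact: measurable_iter.
Qed.

(** Poincare recurrence: the points that never return form a set all of whose
    preimages are disjoint. *)
Lemma poincare_recurrence T A : measure_preserving mu T -> measurable A ->
  mu.-negligible (A `\` recurrent T A).
Proof.
move=> mpT mA.
pose W := A `\` \bigcup_(n in [set n | (0 < n)%N]) (iter n T @^-1` A).
have mW : measurable W.
  apply: measurableD => //; apply: bigcup_measurable => n _.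
  exact: measurable_iter.
have sepW N : late_return T N W.
  by move=> i x /andP[i0 _] [_ nA] [Ai _]; apply: nA; exists i.
have W0 : mu W = 0.
  have fin : mu W \is a fin_num by rewrite fin_num_measure.
  apply/eqP; rewrite eq_le measure_ge0 andbT -(fineK fin) lee_fin leNgt.
  apply/negP => pos.
  have := late_return_le mpT mW (sepW (Num.trunc (fine (mu W))^-1)).
  rewrite -(fineK fin) -EFinM lee_fin leNgt => /negP; apply.
  by rewrite -ltr_pdivrMr// div1r truncnS_gt.
apply: (@negligibleS _ _ _ _ (\bigcup_n (iter n T @^-1` W))); last first.
  apply: negligible_bigcup => n; apply: negligible_iter => //.
  exact/negligibleP.
move=> x [Ax nrec].
have ex : exists m, `[< forall n, (m <= n)%N -> ~ A (iter n T x) >].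
  apply: contrapT => nex; apply: nrec; apply/recurrentP => m.
  apply: contrapT => nn; apply: nex; exists m; apply/asboolP => n mn An.
  by apply: nn; exists n.
case: (ex_minnP ex) => [[|m]] /asboolP never min; first by case: (never 0%N).
exists m => //; split.
  apply: contrapT => nAm; suff /min : `[< forall n, (m <= n)%N -> ~ A (iter n T x) >].
    by rewrite ltnn.
  apply/asboolP => n; rewrite leq_eqVlt => /predU1P[<-//|]; exact: never.
by move=> [n /= n0]; rewrite -iterD; apply: never; rewrite -add1n leq_add2r.
Qed.

(** Rokhlin's lemma in the form of a rare set that almost every orbit visits.
    Countably many sets of late return cover the space because a point and its next
    N images are distinguished by finitely many of the separating sets. Each
    orbit is then assigned to the first of these sets that it visits infinitely
    often; the assignment is constant along orbits, so that the union of the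
    assigned parts still has late returns. *)
Lemma sweep_out T N : countably_separated mu -> measure_preserving mu T ->
  aperiodic mu T -> exists E, [/\ measurable E, late_return T N E &
    mu.-negligible [set x | forall n, ~ E (iter n T x)]].
Proof.
move=> [A [mA [Z Z0 sepA]]] mpT aper.
pose side (w : nat * bool) : set X := if w.2 then A w.1 else ~` A w.1.
have mside w : measurable (side w).
  by rewrite /side; case: w.2 => //; exact: measurableC.
(* The i-th set of the list c separates the points of C0 c from their images
   under the (i + 1)-st power of T. *)
pose C0 (c : seq (nat * bool)) : set X := \bigcap_(i in [set i | (i < N)%N])
  (side (nth (0, true) c i) `\` iter i.+1 T @^-1` side (nth (0, true) c i)).
pose C p : set X := if unpickle p is Some c then C0 c else set0.
have mC p : measurable (C p).
  rewrite /C; case: unpickle => // c; apply: bigcap_measurableType => i _.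
  by apply: measurableD => //; exact: measurable_iter.
have sepC p : late_return T N (C p).
  rewrite /C; case: unpickle => // c i x /andP[]; case: i => // i _ iN cx /(_ i iN)[+ _].
  by have [] := cx i iN.
have coverC x : ~ (exists2 n, (0 < n)%N & iter n T x = x) ->
    (forall n, ~ Z (iter n T x)) -> exists p, C p x.
  move=> nper nZ.
  have /choice[f fP] i : exists w, side w x /\ ~ side w (iter i.+1 T x).
    apply: contrapT => nw; apply: nper; exists i.+1 => //.
    apply: sepA; [exact: nZ|exact: (nZ 0%N)|] => k; split=> [Ak|Ak].
      by apply: contrapT => nA; apply: nw; exists (k, false); split=> //=; apply.
    by apply: contrapT => nA; apply: nw; exists (k, true).
  exists (pickle (mkseq f N)); rewrite /C pickleK => i /= iN.
  by rewrite nth_mkseq//; have [] := fP i.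
pose E : set X := \bigcup_p (C p `&` recurrent T (C p) `&`
  \bigcap_(q in [set q | (q < p)%N]) ~` recurrent T (C q)).
exists E; split.
- apply: bigcupT_measurable => p; apply: measurableI.
    by apply: measurableI => //; exact: measurable_recurrent.
  apply: bigcap_measurableType => q _; apply: measurableC.
  exact: measurable_recurrent.
- move=> i x iN [p _ [[Cp rp] np]] [q _ [[Cq /recurrent_iter rq] nq]].
  case: (ltngtP p q) => pq.
  + by apply: (nq p pq); apply/recurrent_iter.
  + exact: (np q pq).
  + by move: Cq; rewrite -pq; exact: sepC.
apply: (@negligibleS _ _ _ _ ([set x | exists2 n, (0 < n)%N & iter n T x = x]
   `|` (\bigcup_n (iter n T @^-1` Z) `|` \bigcup_p (C p `\` recurrent T (C p))))).
  move=> x never; apply: contrapT => /not_orP[nper /not_orP[nZ nC]].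
  have [p Cp] : exists p, C p x by apply: coverC => // n Zn; apply: nZ; exists n.
  have ex : exists p, `[< recurrent T (C p) x >].
    by exists p; apply/asboolP; apply: contrapT => nr; apply: nC; exists p.
  case: (ex_minnP ex) => q /asboolP rq min.
  have [n _ Cn] := (recurrentP T (C q) x).1 rq 0%N.
  apply: (never n); exists q => //; split; first by split=> //; apply/recurrent_iter.
  move=> r /= rq' /recurrent_iter rr.
  have rb : `[< recurrent T (C r) x >] by apply/asboolP.
  by have := min r rb; rewrite leqNgt rq'.
apply: negligibleU => //; apply: negligibleU.
  by apply: negligible_bigcup => n; exact: negligible_iter.
by apply: negligible_bigcup => p; exact: poincare_recurrence.
Qed.

End Recurrence.

(** * One level of the lower bound *)

Section HittingTimes.
Context (d : measure_display) (X : measurableType d) (R : realType).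
Variable mu : probability X R.
Variable T : X -> X.
Implicit Types (E : set X) (P : pred nat).

Definition hit E n : set X :=
  [set x | E (iter n T x) /\ forall j, (j < n)%N -> ~ E (iter j T x)].

Definition hit_in E P : set X := \bigcup_(n in [set n | P n]) hit E n.

Lemma hit_uniq E m n x : hit E m x -> hit E n x -> m = n.
Proof.
move=> [Em nm] [En nn]; case: (ltngtP m n) => // lt; first by case: (nn _ lt).
by case: (nm _ lt).
Qed.

Lemma hit_iter E n j x : hit E n x -> (j <= n)%N -> hit E (n - j) (iter j T x).
Proof.
move=> [En nE] jn; split; first by rewrite -iterD subnK.
by move=> i ij; rewrite -iterD; apply: nE; rewrite addnC -ltn_subRL.
Qed.

Lemma hit_exists E x : (exists n, E (iter n T x)) -> exists n, hit E n x.
Proof.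
move=> [n En]; have ex : exists n, `[< E (iter n T x) >] by exists n; apply/asboolP.
case: (ex_minnP ex) => m /asboolP Em min; exists m; split=> // j jm Ej.
have := min j; rewrite leqNgt jm => h.
by have : false by apply: h; apply/asboolP.
Qed.

Lemma hit_inE E P n x : hit E n x -> hit_in E P x <-> P n.
Proof.
by move=> hn; split=> [[m /= Pm] /(hit_uniq hn) ->//|Pn]; exists n.
Qed.

Hypothesis mpT : measure_preserving mu T.

Lemma measurable_hit E n : measurable E -> measurable (hit E n).
Proof.
move=> mE.
have -> : hit E n = iter n T @^-1` E `&`
    \bigcap_(j in [set j | (j < n)%N]) ~` (iter j T @^-1` E) by [].
apply: measurableI; first exact: (measurable_iter n mpT mE).
apply: bigcap_measurableType => j _; apply: measurableC.
exact: (measurable_iter j mpT mE).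
Qed.

Lemma measurable_hit_in E P : measurable E -> measurable (hit_in E P).
Proof. by move=> mE; apply: bigcup_measurable => n _; exact: measurable_hit. Qed.

End HittingTimes.

Section Averaging.
Context (d : measure_display) (X : measurableType d) (R : realType).
Variable mu : probability X R.

(** The average measure of a finite family of sets is bounded by the largest
    proportion of them that a single point belongs to. *)
Lemma sum_measure_le (I : Type) (s : seq I) (U : I -> set X) (p : R) :
  (forall i, measurable (U i)) -> (forall x, \sum_(i <- s) \1_(U i) x <= p) ->
  \sum_(i <- s) fine (mu (U i)) <= p.
Proof.
move=> mU le; rewrite -lee_fin -sumEFin.
rewrite (eq_bigr (fun i => \int[mu]_x (\1_(U i) x)%:E)%E); last first.
  by move=> i _; rewrite integral_indic// setIT fineK// fin_num_measure.
have mI i : measurable_fun setT (EFin \o (\1_(U i) : X -> R)).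
  by apply/measurable_EFinP; exact: measurable_indic.
have I0 i x : setT x -> (0 <= (\1_(U i) x)%:E :> \bar R)%E by rewrite lee_fin.
rewrite -(ge0_integral_sum _ measurableT mI I0).
apply: (@le_trans _ _ (\int[mu]_x (cst p%:E x))%E).
  apply: ge0_le_integral => //.
  - by move=> x _; apply: sume_ge0 => i _; rewrite lee_fin.
  - exact: emeasurable_sum.
  - by move=> x _; rewrite /= sumEFin lee_fin.
by rewrite integral_cst// [X in (_ * X)%E](probability_setT mu) mule1.
Qed.

(** The average of f/p + g/r is at most 2, so some value is. *)
Lemma average_choice (I : eqType) (s : seq I) (f g : I -> R) (p r : R) :
  (0 < size s)%N -> 0 < p -> 0 < r ->
  \sum_(i <- s) f i <= p * (size s)%:R -> \sum_(i <- s) g i <= r * (size s)%:R ->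
  (forall i, 0 <= f i) -> (forall i, 0 <= g i) ->
  exists i, f i <= 2 * p /\ g i <= 2 * r.
Proof.
move=> s0 p0 r0 fs gs f0 g0; apply: contrapT => none.
have big i : 2 < f i / p + g i / r.
  have fp : 0 <= f i / p by rewrite divr_ge0// ltW.
  have gr : 0 <= g i / r by rewrite divr_ge0// ltW.
  have [le1|gt1] := leP (f i) (2 * p); last first.
    by rewrite (@lt_le_trans _ _ (f i / p)) ?ltr_pdivlMr// lerDl.
  have [le2|gt2] := leP (g i) (2 * r); last first.
    by rewrite (@lt_le_trans _ _ (g i / r)) ?ltr_pdivlMr// lerDr.
  by case: none; exists i.
have lower : (size s)%:R * 2 < \sum_(i <- s) (f i / p + g i / r).
  case: s s0 {fs gs} => // i s _; elim: s i => [|j s IH] i.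
    by rewrite big_seq1 mul1r.
  rewrite big_cons [size _]/= -[_.+2%:R]natr1 mulrDl mul1r [ltLHS]addrC.
  exact: (ltrD (big i) (IH j)).

have upper : \sum_(i <- s) (f i / p + g i / r) <= (size s)%:R * 2.
  rewrite big_split/= -!mulr_suml.
  have h1 : (\sum_(i <- s) f i) / p <= (size s)%:R by rewrite ler_pdivrMr// mulrC.
  have h2 : (\sum_(i <- s) g i) / r <= (size s)%:R by rewrite ler_pdivrMr// mulrC.
  by lra.
by have := lt_le_trans lower upper; rewrite ltxx.
Qed.

End Averaging.

Section OneLevel.
Context (d : measure_display) (X : measurableType d) (R : realType).
Variable mu : probability X R.
Variable T : X -> X.

(** The set B consists of the points with zero syndrome. The exceptional set D
    collects the points served badly, those too close to their entrance into the
    rare set for all shifts to stay below it, and those that never enter it. *)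
Lemma level_function (eps : R) A :
  countably_separated mu -> measure_preserving mu T -> aperiodic mu T ->
  0 < eps <= 1 ->
  exists (lam : R) (B D : set X),
  [/\ 0 <= lam, measurable B, measurable D & lam * fine (mu B) <= eps] /\
  fine (mu D) <= eps /\
  forall x, ~ D x -> exists2 N, (A <= N)%N &
    eps / 128 * Psi R N <= lam * \sum_(1 <= n < N.+1) \1_B (iter (2 ^ n) T x).
Proof.
move=> sep mpT aper /[dup] eps01 /andP[eps0 eps1].
have halves : 2 * (eps / 4) + eps / 2 = eps by field.
have quarters (x y : R) : eps / 4 * (x * y) = 2 * (eps / 8) * y * x by field.
have scaled (x y : R) : x * eps / 2 * y = eps / 64 * (32 * (x * y)) by field.
have halved (x : R) : eps / 128 * x = eps / 64 * (x / 2) by field.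
have [q [a [q0 Aa a0 wide few]]] := good_windows A eps01.
have homo := @window_homo R q a.
pose e := window R q a.
pose K := e q.
have eK : (e q <= K)%N by [].
have Q0 : (0 < 2 ^ K)%N by rewrite expn_gt0.
have q0' : 0 < q%:R :> R by rewrite ltr0n.
have Q0' : 0 < (2 ^ K)%:R :> R by rewrite ltr0n.
(* The preimages of E up to time 2 ^ K have total measure at most eps / 2. *)
have [E [mE sepE never0]] :=
  sweep_out (Num.trunc (2 * (2 ^ K)%:R / eps)) sep mpT aper.
pose s := [seq (u, c) | u <- index_iota 0 (2 ^ K), c <- index_iota 0 q].
have szs : (size s)%:R = (2 ^ K)%:R * q%:R :> R.
  by rewrite size_allpairs !size_iota !subn0 natrM.
pose Bs (w : nat * nat) := hit_in T E (fun n => slot q e w.1 w.2 n == 0%N).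
pose bad := doubling R q a.
pose Ds (w : nat * nat) := hit_in T E (failing q e bad w.1 w.2).
have mBs w : measurable (Bs w) by exact: (measurable_hit_in mpT).
have mDs w : measurable (Ds w) by exact: (measurable_hit_in mpT).
have avg (P : nat * nat -> pred nat) p : 0 <= p ->
    (forall n, \sum_(0 <= u < 2 ^ K) \sum_(0 <= c < q) (P (u, c) n)%:R <= p) ->
    \sum_(w <- s) fine (mu (hit_in T E (P w))) <= p.
  move=> p0 le; apply: sum_measure_le => [w|x]; first exact: (measurable_hit_in mpT).
  have [[n hn]|nhit] := pselect (exists n, hit T E n x).
    rewrite (le_trans _ (le n))// big_allpairs/=.
    apply: ler_sum => u _; apply: ler_sum => c _; rewrite indicE.
    by case: (boolP (_ \in _)) => //; rewrite inE => /(hit_inE _ hn) ->.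
  rewrite big1// => w _; rewrite indicE memNset// => -[n _ hn].
  by apply: nhit; exists n.
have avgB : \sum_(w <- s) fine (mu (Bs w)) <= q%:R^-1 * (size s)%:R.
  rewrite szs mulrCA mulVf ?gt_eqF// mulr1.
  by apply: (avg (fun w n => slot q e w.1 w.2 n == 0%N)) => // n; rewrite count_code.
have avgD : \sum_(w <- s) fine (mu (Ds w)) <= eps / 4 * (size s)%:R.
  apply: (avg (fun w => failing q e bad w.1 w.2)).
    by rewrite mulr_ge0// divr_ge0// ltW.
  move=> n /=; rewrite szs.
  have eps8 : 0 < eps / 8 by rewrite divr_gt0.
  have wide8 g : (g < q)%N -> 4 / (eps / 8) <= (e g.+1 - e g)%:R.
    have -> : 4 / (eps / 8) = 32 / eps by field; rewrite gt_eqF.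
    by move=> _; exact: wide.
  have := count_failing homo eK n eps8 wide8 few.
  set Q := (2 ^ K)%:R; set qr := q%:R; move/le_trans; apply.
  rewrite quarters; exact: lexx.
have [w [Bw Dw]] : exists w, fine (mu (Bs w)) <= 2 * q%:R^-1 /\
    fine (mu (Ds w)) <= 2 * (eps / 4).
  apply: (average_choice _ _ _ avgB avgD) => [|||w|w].
  - by rewrite size_allpairs !size_iota !subn0 muln_gt0 Q0.
  - by rewrite invr_gt0.
  - by rewrite divr_gt0.
  - by rewrite fine_ge0.
  - by rewrite fine_ge0.
pose never := [set x | forall n, ~ E (iter n T x)].
have mnever : measurable never.
  have -> : never = \bigcap_n ~` (iter n T @^-1` E).
    by apply/seteqP; split=> x nv n; [move=> _|]; exact: nv.
  apply: bigcapT_measurable => n; apply: measurableC.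
  exact: (measurable_iter n mpT mE).
pose early := \big[setU/set0]_(n < 2 ^ K) (iter n T @^-1` E).
have mearly : measurable early.
  by apply: bigsetU_measurable => n _; exact: (measurable_iter n mpT mE).
have early_le : (mu early <= (eps / 2)%:E)%E.
  apply: (@le_trans _ _ (\sum_(n < 2 ^ K) mu (iter n T @^-1` E))%E).
    apply: (Boole_inequality mu (A := fun n => iter n T @^-1` E)) => n _.
    exact: (measurable_iter n mpT mE).
  have fin : mu E \is a fin_num by rewrite fin_num_measure.
  rewrite (eq_bigr (fun=> (fine (mu E))%:E)); last first.
    by move=> n _; rewrite (measure_iter n mpT mE) fineK.
  rewrite sumEFin sumr_const card_ord -[_ *+ (2 ^ K)%N]mulr_natl lee_fin.
  have := late_return_le mpT mE sepE; rewrite -(fineK fin) -EFinM lee_fin.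
  set m := fine (mu E) => mle.
  have m0 : 0 <= m by rewrite fine_ge0.
  have : 2 * (2 ^ K)%:R / eps * m <= 1.
    by rewrite (le_trans _ mle)// ler_wpM2r// ltW// truncnS_gt.
  rewrite mulrAC ler_pdivrMr// mul1r -mulrA => h.
  by rewrite ler_pdivlMr// mulrC.
exists (q%:R * eps / 2), (Bs w), (Ds w `|` (early `|` never)).
split; [split|split].
- by rewrite divr_ge0// mulr_ge0// ltW.
- exact: mBs.
- by apply: measurableU => //; exact: measurableU.
- apply: (@le_trans _ _ (q%:R * eps / 2 * (2 * q%:R^-1))).
    by rewrite ler_wpM2l// divr_ge0// mulr_ge0// ltW.
  by rewrite le_eqVlt; apply/orP; left; apply/eqP; field; rewrite gt_eqF.
- have fD : mu (Ds w) \is a fin_num by rewrite fin_num_measure.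
  have Dw' : (mu (Ds w) <= (2 * (eps / 4))%:E)%E by rewrite -(fineK fD) lee_fin.
  have nev0 : (mu never <= 0)%E by rewrite (iffLR (negligibleP mu mnever) never0).
  have rest : (mu (early `|` never) <= (eps / 2)%:E)%E.
    rewrite -[leRHS]adde0; apply: (le_trans (measureU2 mu mearly mnever)).
    exact: leeD.
  have mrest : measurable (early `|` never) by exact: measurableU.
  have all : (mu (Ds w `|` (early `|` never)) <= eps%:E)%E.
    apply: (le_trans (measureU2 mu (mDs w) mrest)); apply: (le_trans (leeD Dw' rest)).
    by rewrite -EFinD lee_fin halves lexx.
  rewrite -lee_fin fineK//; rewrite fin_num_measure//; exact: measurableU.
move=> x /not_orP[nD /not_orP[nearly nnever]].
have [n hn] : exists n, hit T E n x.
  apply: hit_exists; apply: contrapT => nn; apply: nnever => n En.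
  by apply: nn; exists n.
have Qn : (2 ^ K <= n)%N.
  rewrite leqNgt; apply/negP => nQ; apply: nearly; rewrite /early.
  by rewrite -(bigcup_mkord (2 ^ K) (fun n => iter n T @^-1` E)); exists n => //; case: hn.
have nfail : ~~ failing q e bad w.1 w.2 n.
  by apply/negP => fl; apply: nD; apply/(hit_inE _ hn).
move: nfail; rewrite /failing; set g := slot q e w.1 w.2 n.
rewrite negb_or -leqNgt => /andP[nbad many].
have gq : (g < q)%N by rewrite ltn_mod.
exists (e g.+1).
  by rewrite (leq_trans Aa)// -{1}[a]/(window R q a 0) homo.
have count : (ones (e g) (e g.+1) (n + w.1))%:R <=
    \sum_(1 <= m < (e g.+1).+1) \1_(Bs w) (iter (2 ^ m) T x) :> R.
  have e1 : (1 <= e g)%N by rewrite (leq_trans a0)// -{1}[a]/(window R q a 0) homo.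
  have eg : (e g <= e g.+1)%N by rewrite homo.
  rewrite (@big_cat_nat _ _ _ (e g))//; last by rewrite (leq_trans eg).
  rewrite [X in _ <= _ + X]big_nat_recr//.
  rewrite /ones natr_sum.
  apply: (@le_trans _ _ (\sum_(e g <= m < e g.+1) \1_(Bs w) (iter (2 ^ m) T x))).
    rewrite big_nat [leRHS]big_nat; apply: ler_sum => m mg.
    case: (boolP (bit m (n + w.1))) => [bm|_]; last by rewrite indicE.
    have mK : (m < K)%N.
      by case/andP: mg => _ /leq_trans; apply; exact: (homo _ _ gq).
    have mn : (2 ^ m <= n)%N by rewrite (leq_trans _ Qn)// leq_exp2l// ltnW.
    rewrite indicE mem_set//; apply/(hit_inE _ (hit_iter hn mn)).
    by rewrite (slot_hit homo q0 mg bm mn).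
  have s0 : 0 <= \sum_(1 <= m < e g) \1_(Bs w) (iter (2 ^ m) T x) :> R.
    by apply: sumr_ge0 => m _; rewrite indicE.
  rewrite (le_trans _ (lerD s0 (lexx _)))// add0r lerDl.
  by rewrite indicE.
apply: le_trans (ler_wpM2l _ count); last by rewrite divr_ge0// mulr_ge0// ltW.
have /andP[stepl _] := window_stepP R (e g) q0.
have dbl : Psi R (e g.+1) <= 2 * Psi R (e g).
  by rewrite leNgt; move: nbad; rewrite /bad /doubling.
have m4 : (window_step R q (e g))%:R <= 4 * (ones (e g) (e g.+1) (n + w.1))%:R :> R.
  by rewrite -natrM ler_nat -(addKn (e g) (window_step _ _ _)).
have := le_trans stepl m4.
rewrite ler_pdivrMr ?mulr_gt0//.
move: dbl; set P1 := Psi R (e g.+1); set P0 := Psi R (e g); set o := (ones _ _ _)%:R.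
move=> dbl big.
rewrite scaled halved.
rewrite ler_wpM2l ?divr_ge0 ?(ltW eps0)//.
apply: (@le_trans _ _ P0); first by rewrite ler_pdivrMr// mulrC.
by rewrite (le_trans big)// mulrACA -natrM (mulrC o).
Qed.

End OneLevel.

(** * The lower bound *)

Section Summable.
Context (d : measure_display) (X : measurableType d) (R : realType).
Variable mu : probability X R.

(** Tonelli; it yields almost everywhere finiteness of the series as well. *)
Lemma integrable_nneseries (g : nat -> X -> R) :
  (forall s x, 0 <= g s x) -> (forall s, measurable_fun setT (g s)) ->
  (\sum_(s <oo) \int[mu]_x (g s x)%:E < +oo)%E ->
  mu.-integrable setT (fun x => \sum_(s <oo) (g s x)%:E)%E.
Proof.
move=> g0 mg fin.
have mE s : measurable_fun setT (fun x => (g s x)%:E) by exact/measurable_EFinP.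
have ge0 (s : nat) x : setT x -> (0 <= (g s x)%:E)%E by rewrite lee_fin.
apply/integrableP; split.
  by apply: (ge0_emeasurable_sum (P := xpredT)) => [s x _ _|s _]; [exact: ge0|exact: mE].
have S0 x : (0 <= \sum_(s <oo) (g s x)%:E)%E.
  by apply: nneseries_ge0 => s _ _; rewrite lee_fin.
under eq_integral => x _ do rewrite gee0_abs//.
by rewrite integral_nneseries.
Qed.

End Summable.

Lemma limn_esup_unbounded (R : realType) (u : nat -> R) :
  (forall A n, exists2 N, (n <= N)%N & A <= u N) ->
  limn_esup (fun N => (u N)%:E) = +oo%E.
Proof.
move=> unb; rewrite limn_esup_lim.
have -> : esups (fun N => (u N)%:E) = fun=> +oo%E.
  apply/funext => n; rewrite /esups; apply/eqP.
  rewrite eq_le leey/= leNgt; apply/negP => lt.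
  have [r E] : exists r, ereal_sup (sdrop (fun N => (u N)%:E) n) = r%:E.
    have [N nN _] := unb 0 n.
    have : ((u N)%:E <= ereal_sup (sdrop (fun N => (u N)%:E) n))%E.
      by apply: ereal_sup_ubound; exists N.
    by move: lt; case: (ereal_sup _) => [r _ _|//|//]; exists r.
  have [N nN le] := unb (r + 1) n.
  have : ((u N)%:E <= r%:E)%E by rewrite -E; apply: ereal_sup_ubound; exists N.
  by rewrite lee_fin => /(le_trans le); rewrite gerDl ler10.
exact: lim_cst.
Qed.

Section LowerBound.
Context (d : measure_display) (X : measurableType d) (R : realType).
Variable mu : probability X R.

(** The layers [level_function] with eps = 2^-(s+1) are summed over s. Layer s
    only uses indices N at which M N is already a small multiple of eps Psi N, so
    that this layer alone makes the normalized sum exceed s. *)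
Lemma lower_bound (T : X -> X) (M : nat -> R) :
  countably_separated mu -> measure_preserving mu T -> aperiodic mu T ->
  (forall N, (0 < N)%N -> 0 < M N) ->
  M N / Psi R N @[N --> \oo] --> (0 : R) ->
  exists f : X -> R, mu.-integrable setT (EFin \o f) /\
    {ae mu, forall x, limn_esup (fun N =>
      ((M N)^-1 * \sum_(1 <= n < N.+1) f (iter (2 ^ n) T x))%:E) = +oo%E}.
Proof.
move=> sep mpT aper M0 Mlim.
pose eps s : R := 1 / (2 ^ s.+1)%:R.
have eps01 s : 0 < eps s <= 1.
  rewrite /eps div1r invr_gt0 invf_le1 ltr0n expn_gt0//=.
  by rewrite ler1n expn_gt0.
have small s : exists n0, forall N, (n0 <= N)%N -> M N / Psi R N <= eps s / 128 / s.+1%:R.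
  have pos : 0 < eps s / 128 / s.+1%:R.
    by case/andP: (eps01 s) => e0 _; rewrite divr_gt0 ?ltr0n// divr_gt0 ?ltr0n.
  move/cvgrPdist_le : Mlim => /(_ _ pos)[n0 _ n0P]; exists n0 => N /n0P /=.
  by rewrite sub0r normrN => /(le_trans (ler_norm _)).
have /choice[n0 n0P] := small.
have level s := level_function (maxn s.+1 (n0 s)) sep mpT aper (eps01 s).
have /choice[lam /choice[B /choice[D levelP]]] := level.
pose g s x : R := lam s * \1_(B s) x.
have lam0 s : 0 <= lam s by have [[]] := levelP s.
have mB s : measurable (B s) by have [[]] := levelP s.
have mD s : measurable (D s) by have [[]] := levelP s.
have g0 s x : 0 <= g s x by rewrite mulr_ge0.
have mg s : measurable_fun setT (g s).
  by apply: measurable_funM => //; exact: measurable_indic.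
have intg s : (\int[mu]_x (g s x)%:E <= (eps s)%:E)%E.
  under eq_integral do rewrite EFinM.
  rewrite ge0_integralZl_EFin//; last first.
    by apply/measurable_EFinP; exact: measurable_indic.
  rewrite integral_indic// setIT.
  apply: (@le_trans _ _ ((lam s)%:E * (fine (mu (B s)))%:E)%E).
    by rewrite fineK ?lexx// fin_num_measure.
  by rewrite -EFinM lee_fin; have [[]] := levelP s.
have series_eps : (\sum_(s <oo) (eps s)%:E < +oo)%E.
  exact: le_lt_trans (epsilon_trick0 xpredT ler01) (ltry _).
pose F x : \bar R := (\sum_(s <oo) (g s x)%:E)%E.
have iF : mu.-integrable setT F.
  apply: integrable_nneseries => //; apply: le_lt_trans series_eps.
  by apply: lee_nneseries => [s _ _|s _]; [apply: integral_ge0 => x _; rewrite lee_fin|exact: intg].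
have F0 x : (0 <= F x)%E by apply: nneseries_ge0 => s _ _; rewrite lee_fin.
have mF : measurable_fun setT F by case/integrableP: iF.
exists (fine \o F); split.
  apply: (le_integrable measurableT _ _ iF).
    by apply/measurable_EFinP; apply: measurableT_comp => //; exact: measurable_fine.
  move=> x _ /=; rewrite gee0_abs//.
  by move: (F0 x); case: (F x) => [r r0|_|//]; [rewrite /= ger0_norm|exact: leey].
have D0 : mu (lim_sup_set D) = 0%E.
  apply: lim_sup_set_cvg0 => //; apply: le_lt_trans series_eps.
  apply: lee_nneseries => s _ //.
  apply: (@le_trans _ _ (fine (mu (D s)))%:E).
    by rewrite fineK ?lexx// fin_num_measure.
  by rewrite lee_fin; have [_ []] := levelP s.
have mL : measurable (lim_sup_set D).
  by apply: bigcapT_measurable => n; apply: bigcup_measurable => k _.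
pose infin := [set x | ~ (F x \is a fin_num)].
have inf0 : mu.-negligible infin.
  have := integrable_ae measurableT iF; apply: negligibleS => x nfin fin.
  by apply: nfin; apply: fin.
apply: (@negligibleS _ _ _ _ (lim_sup_set D `|` \bigcup_n (iter n T @^-1` infin))); last first.
  apply: negligibleU; first exact/negligibleP.
  by apply: negligible_bigcup => n; exact: negligible_iter.
move=> x /= nlim; apply: contrapT => /not_orP[nD nI]; apply: nlim.
have finF n : F (iter n T x) \is a fin_num.
  by apply: contrapT => ninf; apply: nI; exists n.
have gF s n : g s (iter n T x) <= fine (F (iter n T x)).
  rewrite -lee_fin fineK//.
  have := @nneseries_lim_ge R (fun s => (g s (iter n T x))%:E) xpredT 0 s.+1.
  rewrite big_nat_recr//= => h; apply: le_trans (h _); last by move=> *; rewrite lee_fin.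
  by rewrite leeDr// sume_ge0// => i _; rewrite lee_fin.
apply: limn_esup_unbounded => A n.
pose s0 := maxn n (Num.trunc A).+1.
have [s s0s nDs] : exists2 s, (s0 <= s)%N & ~ D s x.
  apply: contrapT => nex; apply: nD => m _.
  exists (maxn m s0); first by rewrite /= leq_maxl.
  by apply: contrapT => nDx; apply: nex; exists (maxn m s0); rewrite ?leq_maxr.
have [_ [_ /(_ x nDs)[N AN big]]] := levelP s.
have sN : (s < N)%N by apply: leq_trans AN; rewrite leq_maxl.
exists N; first by rewrite (leq_trans _ (ltnW sN))// (leq_trans _ s0s)// leq_maxl.
have N0 : (0 < N)%N by exact: leq_ltn_trans sN.
have M0N := M0 N N0.
have As : A <= s.+1%:R.
  rewrite (le_trans (ltW (truncnS_gt A)))// ler_nat leqW//.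
  by rewrite (leq_trans _ s0s)// leq_maxr.
apply: (le_trans As); rewrite mulrC ler_pdivlMr//.
have := n0P s N; rewrite (leq_trans _ AN) ?leq_maxr// => /(_ isT).
rewrite ler_pdivrMr ?Psi_gt0// mulrAC ler_pdivlMr ?ltr0n// mulrC => /le_trans; apply.
apply: (le_trans big); rewrite mulr_sumr; apply: ler_sum => k _.
exact: gF.
Qed.

End LowerBound.

(** * The upper bound *)

Section SummableSmall.
Context (d : measure_display) (X : measurableType d) (R : realType).
Variable mu : probability X R.

Lemma ae_eventually_small (g : nat -> X -> R) :
  (forall s x, 0 <= g s x) -> (forall s, measurable_fun setT (g s)) ->
  (\sum_(s <oo) \int[mu]_x (g s x)%:E < +oo)%E ->
  {ae mu, forall x (e : R), 0 < e -> exists k0, forall k, (k0 <= k)%N -> g k x < e}.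
Proof.
move=> g0 mg fin; have := integrable_ae measurableT (integrable_nneseries g0 mg fin).
apply: negligibleS => x /= nsmall finx; apply: nsmall => e e0.
have {}finx := finx I.
have : cvgn (series (g ^~ x)).
  apply: nondecreasing_is_cvgn.
    by apply/nondecreasing_seqP => n; rewrite /series/= big_nat_recr//= lerDl.
  exists (fine (\sum_(s <oo) (g s x)%:E)%E) => _ [n _ <-].
  rewrite -lee_fin fineK// /series/= -sumEFin.
  by apply: nneseries_lim_ge => s _ _; rewrite lee_fin.
move/cvg_series_cvg_0/cvgrPdist_lt => /(_ e e0)[k0 _ small].
by exists k0 => k /small /=; rewrite sub0r normrN ger0_norm.
Qed.

Lemma ge0_integral_lincomb (a b : R) (g h : X -> R) : 0 <= a -> 0 <= b ->
  (forall x, 0 <= g x) -> (forall x, 0 <= h x) ->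
  measurable_fun setT g -> measurable_fun setT h ->
  (\int[mu]_x (a * g x + b * h x)%:E =
   a%:E * \int[mu]_x (g x)%:E + b%:E * \int[mu]_x (h x)%:E)%E.
Proof.
move=> a0 b0 g0 h0 mg mh.
have mgE : measurable_fun setT (EFin \o g) by exact/measurable_EFinP.
have mhE : measurable_fun setT (EFin \o h) by exact/measurable_EFinP.
under eq_integral do rewrite EFinD !EFinM.
rewrite ge0_integralD//.
- by rewrite !ge0_integralZl_EFin// => x _; rewrite /= lee_fin.
- by move=> x _; rewrite -EFinM lee_fin mulr_ge0.
- exact: measurable_funeM.
- by move=> x _; rewrite -EFinM lee_fin mulr_ge0.
- exact: measurable_funeM.
Qed.

End SummableSmall.

Section Bins.
Variables (R : realType) (u : nat -> R).

(** Every number lies in at most three of the overlapping bins. *)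
Lemma sum_bins_le y n : 0 <= y -> (forall k, u k <= u k.+1) ->
  \sum_(0 <= k < n) y * (u k < y <= u k.+3)%R%:R <= 3 * y.
Proof.
move=> y0 mono; rewrite -mulr_sumr mulrC ler_wpM2r//.
pose p k : R := (u k < y)%R%:R.
have bin k : (u k < y <= u k.+3)%R%:R = p k - p k.+3.
  rewrite /p; have le3 := le_trans (mono k) (le_trans (mono k.+1) (mono k.+2)).
  case: (ltP (u k.+3) y) => [lt|_]; last by rewrite andbT subr0.
  by rewrite (le_lt_trans le3 lt) subrr.
suff -> : \sum_(0 <= k < n) (u k < y <= u k.+3)%R%:R =
    p 0%N + p 1%N + p 2%N - (p n + p n.+1 + p n.+2).
  have p0 k : 0 <= p k by [].
  have p1 k : p k <= 1 by rewrite /p; case: (_ < _).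
  rewrite lerBlDr; apply: (le_trans (lerD (lerD (p1 0%N) (p1 1%N)) (p1 2%N))).
  have -> : 1 + 1 + 1 = 3 :> R by ring.
  by rewrite lerDl !addr_ge0.
elim: n => [|n IH]; first by rewrite big_geq// subrr.
by rewrite big_nat_recr//= IH bin; ring.
Qed.

(** The terms below y grow geometrically, so the last one dominates. *)
Lemma sum_below_le y n : 0 <= y -> (forall k, 0 <= u k) ->
  (forall k, 2 * u k <= u k.+1) ->
  \sum_(0 <= k < n) u k * (u k < y)%R%:R <= 2 * y.
Proof.
move=> y0 u0 grow.
have geo m : \sum_(0 <= k < m) u k <= u m.
  elim: m => [|m IH]; first by rewrite big_geq.
  rewrite big_nat_recr//= (le_trans (lerD IH (lexx _)))//.
  by rewrite -mulr2n -mulr_natl.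
elim: n => [|n IH]; first by rewrite big_geq// mulr_ge0.
rewrite big_nat_recr//=; case: ltP => [lt|_]; last by rewrite mulr0 addr0.
have -> : 2 * y = y + y by rewrite mulr_natl mulr2n.
rewrite mulr1; apply: lerD; last exact: ltW.
apply: le_trans (ltW lt); apply: le_trans (geo n); apply: ler_sum => k _.
by case: (_ < _); rewrite ?mulr1// mulr0.
Qed.

End Bins.

Section UpperBound.
Context (d : measure_display) (X : measurableType d) (R : realType).
Variable mu : probability X R.
Variables (tau : nat -> X -> X) (f : X -> R).
Hypothesis mp_tau : forall n, (0 < n)%N -> measure_preserving mu (tau n).
Hypothesis int_f : mu.-integrable setT (EFin \o f).

Let h x := `|f x|.
Let Y k x := h x * (tower R k.+1 < h x <= tower R k.+4)%R%:R.
Let z k x : R := (tower R k.+4 < h x)%R%:R.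
Let m k := Num.trunc (tower R k.+4).
(** The majorant of level k + 3: the middle range of values with its weights, and
    the number of occurrences of values that are too large. *)
Let G k x := \sum_(0 <= n < m k)
  (weight R k.+3 n.+1 * Y k (tau n.+1 x) + z k (tau n.+1 x)).

Let mf : measurable_fun setT f.
Proof. by have /integrableP[/measurable_EFinP] := int_f. Qed.

Let mh : measurable_fun setT h.
Proof. exact: measurableT_comp mf. Qed.

Let mY k : measurable_fun setT (Y k).
Proof.
pose A := h @^-1` [set` `]tower R k.+1, tower R k.+4]].
have mA : measurable A by rewrite -[A]setTI; exact: mh.
have -> : Y k = h \* \1_A.
  apply/funext => x; rewrite /Y /= indicE; congr (_ * _%:R); congr nat_of_bool.
  by apply/idP/idP; rewrite inE /A /= in_itv/=.
by apply: measurable_funM => //; exact: measurable_indic.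
Qed.

Let mz k : measurable_fun setT (z k).
Proof.
pose A := h @^-1` [set` `]tower R k.+4, +oo[].
have mA : measurable A by rewrite -[A]setTI; exact: mh.
have -> : z k = \1_A; last exact: measurable_indic.
apply/funext => x; rewrite /z indicE; congr (_%:R); congr nat_of_bool.
by apply/idP/idP; rewrite inE /A /= in_itv/= andbT.
Qed.

Let h0 x : 0 <= h x. Proof. exact: normr_ge0. Qed.
Let Y0 k x : 0 <= Y k x. Proof. by rewrite mulr_ge0. Qed.
Let z0 k x : 0 <= z k x. Proof. by []. Qed.

Let term0 k n y : 0 <= weight R k.+3 n * Y k y + z k y.
Proof. by rewrite addr_ge0// mulr_ge0// weight_ge0. Qed.

Let G0 k x : 0 <= G k x.
Proof. by apply: sumr_ge0. Qed.

Let invariance n (g : X -> R) : (0 < n)%N -> measurable_fun setT g ->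
  (forall x, 0 <= g x) -> (\int[mu]_x (g (tau n x))%:E = \int[mu]_x (g x)%:E)%E.
Proof.
move=> n0 mg g0; have [mt inv] := mp_tau n0.
have mgE : measurable_fun setT (EFin \o g) by exact/measurable_EFinP.
have := @ge0_integral_pushforward _ _ _ _ _ _ mt mu setT _ measurableT mgE.
rewrite preimage_setT => <-; last by move=> y _ /=; rewrite lee_fin.
by apply: eq_measure_integral => A mA _; exact: inv.
Qed.

Let mcomp n (g : X -> R) : (0 < n)%N -> measurable_fun setT g ->
  measurable_fun setT (fun x => g (tau n x)).
Proof. by move=> n0 mg; have [mt _] := mp_tau n0; exact: measurableT_comp. Qed.

(** A function that bounds the integral of G and is summable over k. *)
Let W k x := 3 * Y k x + tower R k.+4 * z k x.

Let mterm k n : measurable_fun setT (fun x => weight R k.+3 n * Y k x + z k x).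
Proof. by apply: measurable_funD => //; exact: measurable_funM. Qed.

Let mG k : measurable_fun setT (G k).
Proof.
apply: measurable_sum => n; exact: (mcomp (ltn0Sn n) (mterm k n.+1)).
Qed.

Let mW k : measurable_fun setT (W k).
Proof. by apply: measurable_funD; apply: measurable_funM. Qed.

Let W0 k x : 0 <= W k x.
Proof. by rewrite addr_ge0// mulr_ge0// ltW// tower_gt0. Qed.

(** Invariance replaces every translate by the function itself; the weights then
    sum up to at most 3. *)
Let integral_G k : (\int[mu]_x (G k x)%:E <= \int[mu]_x (W k x)%:E)%E.
Proof.
set IY := (\int[mu]_x (Y k x)%:E)%E; set Iz := (\int[mu]_x (z k x)%:E)%E.
have IY0 : (0 <= IY)%E by apply: integral_ge0 => x _; rewrite lee_fin.
have Iz0 : (0 <= Iz)%E by apply: integral_ge0 => x _; rewrite lee_fin.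
have -> : (\int[mu]_x (G k x)%:E =
    \sum_(0 <= n < m k) ((weight R k.+3 n.+1)%:E * IY + Iz))%E.
  under eq_integral do rewrite /G -sumEFin.
  rewrite ge0_integral_sum//.
  - apply: eq_bigr => n _.
    rewrite (invariance (ltn0Sn n) (mterm k n.+1) (term0 k n.+1)).
    have := ge0_integral_lincomb mu (weight_ge0 R k.+3 n.+1) ler01 (Y0 k) (z0 k) (mY k) (mz k).
    by rewrite mul1e => <-; apply: eq_integral => x _; rewrite mul1r.
  - by move=> n; apply/measurable_EFinP; exact: (mcomp (ltn0Sn n) (mterm k n.+1)).
  - by move=> n x _; rewrite lee_fin term0.
have t0 := ltW (tower_gt0 R k.+4).
have -> : (\int[mu]_x (W k x)%:E = 3%:E * IY + (tower R k.+4)%:E * Iz)%E.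
  exact: ge0_integral_lincomb.
rewrite big_split/= leeD//.
  rewrite -ge0_sume_distrl; last by move=> n _; rewrite lee_fin weight_ge0.
  rewrite sumEFin lee_wpmul2r// lee_fin -(big_add1 _ _ 0 (m k).+1 xpredT) sum_weight//.
  by rewrite /m truncn_le.
rewrite [leLHS](_ : _ = (m k)%:R%:E * Iz)%E.
  by rewrite lee_wpmul2r// lee_fin /m truncn_le.
elim: (m k) => [|n IH]; first by rewrite big_geq// mul0e.
rewrite big_nat_recr//= IH -[n.+1%:R]natr1 EFinD ge0_muleDl ?mul1e// lee_fin//.
Qed.

Let sum_W n x : \sum_(0 <= k < n) W k x <= 11 * h x.
Proof.
rewrite /W big_split/= -mulr_sumr.
have hY := sum_bins_le n (h0 x) (fun k => tower_le R (leqnSn k.+1)).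
have grow k : 2 * tower R k.+4 <= tower R k.+1.+4 by exact: towerS_ge.
have hz := sum_below_le n (h0 x) (fun k => ltW (tower_gt0 R k.+4)) grow.
have -> : 11 * h x = 3 * (3 * h x) + 2 * h x by ring.
apply: lerD; last exact: hz.
by rewrite ler_wpM2l.
Qed.

Let summable_G : (\sum_(k <oo) \int[mu]_x (G k x)%:E < +oo)%E.
Proof.
have mWE k : measurable_fun setT (EFin \o W k) by exact/measurable_EFinP.
apply: (@le_lt_trans _ _ (\sum_(k <oo) \int[mu]_x (W k x)%:E)%E).
  by apply: lee_nneseries => [k _ _|k _]; [apply: integral_ge0 => x _; rewrite lee_fin|exact: integral_G].
rewrite -(integral_nneseries mu measurableT mWE); last by move=> k x _; rewrite lee_fin.
apply: (@le_lt_trans _ _ (\int[mu]_x (11%:E * (h x)%:E))%E).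
  apply: ge0_le_integral => //.
  - by move=> x _; apply: nneseries_ge0 => k _ _; rewrite lee_fin.
  - apply: (ge0_emeasurable_sum (P := xpredT)) => [k x _ _|k _]; last exact: mWE.
    by rewrite lee_fin.
  - by apply: measurable_funeM; exact/measurable_EFinP.
  - move=> x _; rewrite -EFinM; apply: lime_le.
      by apply: is_cvg_nneseries => k _ _; rewrite lee_fin.
    by apply: nearW => n /=; rewrite sumEFin lee_fin sum_W.
have mhE : measurable_fun setT (EFin \o h) by exact/measurable_EFinP.
rewrite ge0_integralZl_EFin//; last by move=> x _; rewrite lee_fin.
by rewrite lte_mul_pinfty//; have /integrableP[] := int_f.
Qed.

(** As soon as G k x < 1, no value above the tower k + 4 occurs among the first N
    terms, and the values below the tower k + 1 add up to at most
    N tower (k+1) <= Psi N / tower (k+1). *)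
Lemma upper_bound : {ae mu, forall x,
  (Psi R N)^-1 * (\sum_(1 <= n < N.+1) f (tau n x)) @[N --> \oo] --> (0 : R)}.
Proof.
have := ae_eventually_small G0 mG summable_G.
apply: negligibleS => x /= ncvg small; apply: ncvg.
apply/cvgrPdist_le => e e0.
have e2 : 0 < Num.min (e / 2) 1 by rewrite lt_min ltr01 divr_gt0.
have [k0 k0P] := small _ e2.
pose k1 := maxn k0 (Num.trunc (2 / e)).+1.
near=> N.
have N1 : (1 < N)%N by near: N; exists 2%N.
have Nk : tower R k1.+3 < N%:R.
  near: N; exists (Num.trunc (tower R k1.+3)).+1 => // n /= le.
  by rewrite (lt_le_trans (truncnS_gt _))// ler_nat.
have [j lev] := level_exists R N1; have /andP[jN Nj] := lev.
have jk : (k1.+3 <= j)%N.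
  rewrite leqNgt; apply/negP => lt.
  by have := lt_le_trans Nk (le_trans Nj (tower_le R lt)); rewrite ltxx.
pose k := (j - 3)%N.
have jE : j = k.+3 by rewrite /k; lia.
have k1k : (k1 <= k)%N by rewrite /k; lia.
rewrite jE in jN Nj.
have : G k x < Num.min (e / 2) 1 by apply: k0P; rewrite (leq_trans _ k1k)// leq_maxl.
rewrite lt_min => /andP[Ge G1].
have Nm : (N <= m k)%N by rewrite /m truncn_ge_nat// ltW// tower_gt0.
have P0 := Psi_gt0 R N.
have hle n : (n < N)%N -> h (tau n.+1 x) <= tower R k.+1 + Y k (tau n.+1 x).
  move=> nN; have zG : z k (tau n.+1 x) <= G k x.
    rewrite /G (bigD1_seq n) ?iota_uniq ?mem_index_iota ?(leq_trans nN)//=.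
    rewrite -[leLHS]addr0; apply: lerD; last exact: sumr_ge0.
    by rewrite lerDr mulr_ge0// weight_ge0.
  have le : h (tau n.+1 x) <= tower R k.+4.
    rewrite leNgt; apply/negP => lt.
    by have := le_lt_trans zG G1; rewrite /z lt ltxx.
  rewrite /Y le andbT; case: ltP => [lt|le']; last by rewrite mulr0 addr0.
  by rewrite mulr1 lerDr ltW// tower_gt0.
rewrite sub0r normrN normrM gtr0_norm ?invr_gt0// mulrC ler_pdivrMr//.
rewrite (le_trans (ler_norm_sum _ _ _))// big_add1/=.
apply: (@le_trans _ _ (\sum_(0 <= n < N) (tower R k.+1 + Y k (tau n.+1 x)))).
  by rewrite big_nat [leRHS]big_nat; apply: ler_sum => n /andP[_ nN]; exact: hle.
rewrite big_split/= big_const_nat subn0 iter_addr_0.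
have -> : e * Psi R N = e / 2 * Psi R N + e / 2 * Psi R N by field.
apply: lerD.
  have Pge : N%:R * tower R k.+2 <= Psi R N by exact: Psi_ge.
  have t0 := tower_gt0 R k.+1.
  have et : 1 <= e / 2 * tower R k.+1.
    rewrite -ler_pdivrMl ?divr_gt0// mulr1 invf_div.
    rewrite (le_trans (ltW (truncnS_gt _)))// (le_trans _ (tower_ge R k.+1))// ler_nat.
    by rewrite leqW// leqW// (leq_trans _ k1k)// leq_maxr.
  apply: (@le_trans _ _ (e / 2 * (N%:R * tower R k.+2))); last first.
    by rewrite ler_wpM2l// divr_ge0// ltW.
  have sq : tower R k.+1 ^+ 2 <= tower R k.+2 by rewrite towerS sqr_le_expR// ltW.
  rewrite mulrCA -[leLHS]mulr_natl ler_wpM2l//.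
  apply: (@le_trans _ _ (e / 2 * tower R k.+1 ^+ 2)).
    by rewrite expr2 mulrA ler_peMl// ltW.
  by rewrite ler_wpM2l// divr_ge0// ltW.
apply: (@le_trans _ _ (G k x * Psi R N)); last by rewrite ler_wpM2r// ltW.
rewrite -ler_pdivrMr// mulr_suml.
rewrite /G (@big_cat_nat _ _ _ N 0 (m k))//=.
apply: (@le_trans _ _ (\sum_(0 <= n < N) (weight R k.+3 n.+1 * Y k (tau n.+1 x) + z k (tau n.+1 x)))).
  rewrite big_nat [leRHS]big_nat; apply: ler_sum => n /andP[_ nN].
  rewrite mulrC -[leLHS]addr0 lerD// ler_wpM2r//.
  exact: weight_ge.
by rewrite lerDl; apply: sumr_ge0.
Unshelve. all: by end_near.
Qed.

End UpperBound.

(** * Powers of the transformation and the theorem *)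

Section Powers.
Context (d : measure_display) (X : measurableType d) (R : realType).
Variable mu : probability X R.
Implicit Types (T S : X -> X).

Lemma measure_preserving_iter T n :
  measure_preserving mu T -> measure_preserving mu (iter n T).
Proof.
move=> mpT; split=> [_ B mB|A mA]; last exact: measure_iter.
by rewrite setTI; exact: (measurable_iter n mpT mB).
Qed.

(** The preimage of A under S is, up to a null set, the set whose preimage under
    T is A. *)
Lemma measure_preserving_inverse T S :
  measure_preserving mu T -> ae_inverse mu T S -> measure_preserving mu S.
Proof.
move=> [mT inv] [mS [N [mN N0 sub]] _]; split=> // A mA.
have mSA : measurable (S @^-1` A) by rewrite -[X in measurable X]setTI; exact: mS.
have mTSA : measurable (T @^-1` (S @^-1` A)).
  by rewrite -[X in measurable X]setTI; exact: mT.
have le B C : measurable B -> measurable C -> B `<=` C `|` N -> (mu B <= mu C)%E.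
  move=> mB mC BC; have N0' : (mu N <= 0)%E by rewrite N0.
  rewrite -[leRHS]adde0; apply: le_trans (leeD (lexx _) N0').
  apply: le_trans (measureU2 mu mC mN).
  by apply: le_measure; rewrite ?inE//; exact: measurableU.
have off x : ~ N x -> S (T x) = x.
  by move=> nN; apply: contrapT => ne; apply: nN; exact: sub.
rewrite -(inv _ mSA); apply/eqP; rewrite eq_le; apply/andP; split.
  apply: le => // x ASTx; have [Nx|nN] := pselect (N x); [by right|left].
  by rewrite -(off x nN).
apply: le => // x Ax; have [Nx|nN] := pselect (N x); [by right|left].
by rewrite /= off.
Qed.

Lemma measure_preserving_tpow T S a n :
  measure_preserving mu T -> admissible_times mu T S a -> (0 < n)%N ->
  measure_preserving mu (tpow T S (a n)).
Proof.
move=> mpT [inv|pos] n0; last first.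
  by have := pos n n0; case: (a n) => // k _; exact: measure_preserving_iter.
case: (a n) => k; first exact: measure_preserving_iter.
exact: (measure_preserving_iter k.+1 (measure_preserving_inverse mpT inv)).
Qed.

End Powers.

Theorem theorem1 (R : realType) :
  (forall (d : measure_display) (X : measurableType d) (mu : probability X R)
      (T S : X -> X) (f : X -> R) (a : nat -> int),
    measure_preserving mu T ->
    mu.-integrable setT (EFin \o f) ->
    admissible_times mu T S a ->
    {ae mu, forall x,
      (Psi R N)^-1 * orbit_sum T S f a N x @[N --> \oo] --> (0 : R)})
  /\
  (forall (d : measure_display) (X : measurableType d) (mu : probability X R)
      (T S : X -> X) (M : nat -> R),
    countably_separated mu ->
    measure_preserving mu T ->
    aperiodic mu T ->
    (forall N, (0 < N)%N -> 0 < M N) ->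
    M N / Psi R N @[N --> \oo] --> (0 : R) ->
    (exists (f : X -> R) (a : nat -> int),
      [/\ mu.-integrable setT (EFin \o f),
          admissible_times mu T S a &
          {ae mu, forall x,
            limn_esup (fun N => ((M N)^-1 * orbit_sum T S f a N x)%:E)
            = +oo%E}])
    /\
    (exists f : X -> R,
      mu.-integrable setT (EFin \o f) /\
      {ae mu, forall x,
        limn_esup (fun N =>
          ((M N)^-1 * orbit_sum T S f (fun n => (2 ^ n)%N%:Z) N x)%:E)
        = +oo%E})).
Proof.
split=> [d X mu T S f a mpT intf adm|d X mu T S M sep mpT aper M0 Mlim].
  exact: (upper_bound (fun n n0 => measure_preserving_tpow mpT adm n0) intf).
have [f [intf unbounded]] := lower_bound sep mpT aper M0 Mlim.
split; last by exists f.
exists f, (fun n => (2 ^ n)%N%:Z); split=> //.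
by right.
Qed.
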